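(* Let $\Gamma$ be a bicombable finitely generated group (with a word metric) which is coarsely path-connected. Then $\mathrm{c\text{-}cat}(\Gamma)\le\mathrm{asdim}(\Gamma)$.
   Context: Notation: $\mathbb{R}_+=[0,\infty)$, $\mathbb{N}=\{0,1,\dots\}$. A (not necessarily continuous) map is controlled if for every $r>0$ there is $S>0$ with $d(x,x')<r\Rightarrow d(f(x),f(x'))<S$; proper if preimages of bounded sets are bounded; coarse if both. A bicombing on a metric space $X$ is a controlled map $C:X\times X\times\mathbb{N}\to X$, $C_p(x,n)=C(p,x,n)$, with $C_p(x,0)=C_p(p,n)=p$ and such that for each $p$ and bounded $K$ there is $N$ with $C_p(x,n)=x$ for $n\ge N$, $x\in K$; $\Gamma$ is bicombable if it admits one for its word metric. For a coarse $q:A\to\mathbb{R}_+$, $I_qA=\{(x,t)\in A\times\mathbb{R}_+: t\le q(x)\}$ (product sup metric), $i_0(x)=(x,0)$, $i_1(x)=(x,q(x))$; coarse maps $f,g:A\to X$ are coarsely homotopic if there exist a coarse $q$ and a coarse $H:I_qA\to X$ with $H\circ i_0=f$, $H\circ i_1=g$. A coarse $\mathbb{R}_+$-basepoint is a coarse map $\mathbb{R}_+\to X$ close to a quasi-geodesic ray; $X$ is coarsely path-connected if any two coarse $\mathbb{R}_+$-basepoints are coarsely homotopic. $A\subseteq X$ is coarsely categorical if there are coarse maps $\alpha:\mathbb{R}_+\to X$, $j:A\to\mathbb{R}_+$ with $\alpha\circ j$ coarsely homotopic to the inclusion; $\mathrm{c\text{-}cat}(X)$ is the least $k$ such that $X$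 is covered by $k+1$ coarsely categorical sets; $\mathrm{c\text{-}cat}(\Gamma)$ is $\mathrm{c\text{-}cat}$ of any proper geodesic space on which $\Gamma$ acts properly cocompactly by isometries (a coarse homotopy invariant). $\mathrm{asdim}(X)\le n$ means: for every $r<\infty$ there exist $r$-disjoint families $\mathcal{U}^0,\dots,\mathcal{U}^n$ of uniformly bounded subsets covering $X$.
   Formalization: Coarsely path-connected is taken to include existence of a coarse R_+-basepoint (i.e. Γ infinite), and the space acted on is assumed non-empty; for finite Γ the literal claim fails, since asdim is 0 but no coarse map from R_+ to a bounded space exists. *)

(* Defs.v *)
From Stdlib Require Import Reals List ClassicalEpsilon.
Open Scope R_scope.

Definition is_metric {T : Type} (d : T -> T -> R) : Prop :=
  (forall x y, 0 <= d x y) /\ (forall x, d x x = 0) /\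
  (forall x y, d x y = 0 -> x = y) /\ (forall x y, d x y = d y x) /\
  (forall x y z, d x z <= d x y + d y z).

Definition bounded {T : Type} (d : T -> T -> R) (B : T -> Prop) : Prop :=
  exists r, forall x y, B x -> B y -> d x y <= r.

Definition controlled {T U : Type} (dT : T -> T -> R) (dU : U -> U -> R)
  (f : T -> U) : Prop :=
  forall r, 0 < r -> exists s, 0 < s /\
    forall x x', dT x x' < r -> dU (f x) (f x') < s.

Definition proper_map {T U : Type} (dT : T -> T -> R) (dU : U -> U -> R)
  (f : T -> U) : Prop :=
  forall B, bounded dU B -> bounded dT (fun x => B (f x)).

Definition coarse {T U : Type} (dT : T -> T -> R) (dU : U -> U -> R)
  (f : T -> U) : Prop := controlled dT dU f /\ proper_map dT dU f.

Definition Rplus := { t : R | 0 <= t }.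
Definition dRp (s t : Rplus) : R := Rabs (proj1_sig s - proj1_sig t).

Definition Iq {A : Type} (q : A -> Rplus) :=
  { p : A * R | 0 <= snd p <= proj1_sig (q (fst p)) }.

Definition dIq {A : Type} (dA : A -> A -> R) (q : A -> Rplus) (p p' : Iq q) : R :=
  Rmax (dA (fst (proj1_sig p)) (fst (proj1_sig p')))
       (Rabs (snd (proj1_sig p) - snd (proj1_sig p'))).

Definition i0 {A : Type} (q : A -> Rplus) (x : A) : Iq q :=
  exist _ (x, 0) (conj (Rle_refl 0) (proj2_sig (q x))).

Definition i1 {A : Type} (q : A -> Rplus) (x : A) : Iq q :=
  exist _ (x, proj1_sig (q x)) (conj (proj2_sig (q x)) (Rle_refl _)).

Definition coarsely_homotopic {A X : Type} (dA : A -> A -> R) (dX : X -> X -> R)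
  (f g : A -> X) : Prop :=
  exists q : A -> Rplus, coarse dA dRp q /\
  exists H : Iq q -> X, coarse (dIq dA q) dX H /\
    (forall x, H (i0 q x) = f x) /\ (forall x, H (i1 q x) = g x).

Definition quasi_geodesic_ray {X : Type} (dX : X -> X -> R) (g : Rplus -> X) : Prop :=
  exists lam c, 1 <= lam /\ 0 <= c /\
    forall s t, / lam * dRp s t - c <= dX (g s) (g t) <= lam * dRp s t + c.

Definition close {T X : Type} (dX : X -> X -> R) (f g : T -> X) : Prop :=
  exists C, forall t, dX (f t) (g t) <= C.

Definition coarse_basepoint {X : Type} (dX : X -> X -> R) (f : Rplus -> X) : Prop :=
  coarse dRp dX f /\ exists g, quasi_geodesic_ray dX g /\ close dX f g.

(** Coarse path-connectedness: we require that a
    coarse R_+-basepoint exists (the analogue of non-emptiness of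
    path-connected spaces) *)
Definition coarsely_path_connected {X : Type} (dX : X -> X -> R) : Prop :=
  (exists f, coarse_basepoint dX f) /\
  forall f g, coarse_basepoint dX f -> coarse_basepoint dX g ->
    coarsely_homotopic dRp dX f g.

Definition subsp {X : Type} (A : X -> Prop) := { x : X | A x }.
Definition dsub {X : Type} (dX : X -> X -> R) (A : X -> Prop) (x y : subsp A) : R :=
  dX (proj1_sig x) (proj1_sig y).

Definition coarsely_categorical {X : Type} (dX : X -> X -> R) (A : X -> Prop) : Prop :=
  exists (alpha : Rplus -> X) (j : subsp A -> Rplus),
    coarse dRp dX alpha /\ coarse (dsub dX A) dRp j /\
    coarsely_homotopic (dsub dX A) dX (fun x => alpha (j x)) (@proj1_sig X A).

Definition ccat_le {X : Type} (dX : X -> X -> R) (n : nat) : Prop :=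
  exists k : nat, (k <= n)%nat /\
    exists U : nat -> X -> Prop,
      (forall i, (i <= k)%nat -> coarsely_categorical dX (U i)) /\
      (forall x, exists i, (i <= k)%nat /\ U i x).

Definition r_disjoint {X : Type} (dX : X -> X -> R) (r : R)
  (F : (X -> Prop) -> Prop) : Prop :=
  forall U V, F U -> F V -> U <> V -> forall x y, U x -> V y -> r < dX x y.

Definition uniformly_bounded {X : Type} (dX : X -> X -> R)
  (F : (X -> Prop) -> Prop) : Prop :=
  exists B, forall U, F U -> forall x y, U x -> U y -> dX x y <= B.

Definition asdim_le {X : Type} (dX : X -> X -> R) (n : nat) : Prop :=
  forall r : R, exists Fam : nat -> (X -> Prop) -> Prop,
    (forall i, (i <= n)%nat -> r_disjoint dX r (Fam i) /\ uniformly_bounded dX (Fam i)) /\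
    (forall x, exists i U, (i <= n)%nat /\ Fam i U /\ U x).

Definition dnat (m n : nat) : R := Rabs (INR m - INR n).

Definition dXXN {X : Type} (dX : X -> X -> R) (a b : (X * X) * nat) : R :=
  Rmax (Rmax (dX (fst (fst a)) (fst (fst b))) (dX (snd (fst a)) (snd (fst b))))
       (dnat (snd a) (snd b)).

Definition is_bicombing {X : Type} (dX : X -> X -> R) (C : X -> X -> nat -> X) : Prop :=
  controlled (dXXN dX) dX (fun a => C (fst (fst a)) (snd (fst a)) (snd a)) /\
  (forall p x, C p x 0%nat = p) /\
  (forall p n, C p p n = p) /\
  (forall p K, bounded dX K ->
     exists N : nat, forall x n, K x -> (N <= n)%nat -> C p x n = x).

Definition bicombable {X : Type} (dX : X -> X -> R) : Prop :=
  exists C, is_bicombing dX C.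

Section Word.
Variables (G : Type) (mul : G -> G -> G) (inv : G -> G) (e : G).

Fixpoint word_val (w : list (bool * G)) : G :=
  match w with
  | nil => e
  | (b, s) :: w' => mul (if b then s else inv s) (word_val w')
  end.

Definition word_len_le (S : list G) (g : G) (n : nat) : Prop :=
  exists w : list (bool * G),
    (forall l, In l w -> In (snd l) S) /\ (length w <= n)%nat /\ word_val w = g.

Definition generates (S : list G) : Prop := forall g, exists n, word_len_le S g n.

Definition word_norm (S : list G) (g : G) : nat :=
  match excluded_middle_informative
          (exists n, word_len_le S g n /\ forall m, word_len_le S g m -> (n <= m)%nat)
  with
  | left H => proj1_sig (constructive_indefinite_description _ H)
  | right _ => 0%nat
  end.

Definition word_dist (S : list G) (x y : G) : R := INR (word_norm S (mul (inv x) y)).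
End Word.

Definition converges {X : Type} (dX : X -> X -> R) (u : nat -> X) (x : X) : Prop :=
  forall eps, 0 < eps -> exists N, forall n, (N <= n)%nat -> dX (u n) x < eps.

Definition compact_set {X : Type} (dX : X -> X -> R) (K : X -> Prop) : Prop :=
  forall u : nat -> X, (forall n, K (u n)) ->
    exists (phi : nat -> nat) (x : X),
      (forall n, (phi n < phi (S n))%nat) /\ K x /\ converges dX (fun n => u (phi n)) x.

Definition proper_space {X : Type} (dX : X -> X -> R) : Prop :=
  forall x r, compact_set dX (fun y => dX x y <= r).

Definition geodesic_space {X : Type} (dX : X -> X -> R) : Prop :=
  forall x y, exists g : R -> X, g 0 = x /\ g (dX x y) = y /\
    forall s t, 0 <= s <= dX x y -> 0 <= t <= dX x y -> dX (g s) (g t) = Rabs (s - t).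

Definition isometric_action {G X : Type} (mul : G -> G -> G) (e : G)
  (dX : X -> X -> R) (act : G -> X -> X) : Prop :=
  (forall x, act e x = x) /\
  (forall g h x, act (mul g h) x = act g (act h x)) /\
  (forall g x y, dX (act g x) (act g y) = dX x y).

Definition proper_action {G X : Type} (dX : X -> X -> R) (act : G -> X -> X) : Prop :=
  forall K, compact_set dX K ->
    exists l : list G, forall g, (exists x, K x /\ K (act g x)) -> In g l.

Definition cocompact_action {G X : Type} (dX : X -> X -> R) (act : G -> X -> X) : Prop :=
  exists K, compact_set dX K /\ forall x, exists g y, K y /\ x = act g y.

(* Main.v *)
From Stdlib Require Import Reals List ClassicalEpsilon Lra Lia ZArith.
From Stdlib Require Import Relation_Operators Operators_Properties.
From Stdlib Require Import FunctionalExtensionality PropExtensionality.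
Require Import Defs.
Open Scope R_scope.

(** Finite asymptotic dimension yields [n+1] sets covering the group, each of
    which is a union of pieces that recede from one another at infinity and are
    small compared with their distance to the identity.  Combing every piece to
    a centre keeps far from the identity because the piece is small, so each set
    deforms to a set of centres.  Coarse path-connectedness forces the group to be
    one-ended (by König's lemma a point cut off by a ball would give a geodesic
    ray cut off by that ball), hence the centres can be joined to the points of a
    fixed ray by chains which escape every ball.  No further control on these
    chains is needed: only finitely many pieces come within a given distance of
    another one.  The result moves to [X] along the orbit map. *)

(** Two quantities resist control: the diameter bound of a cover is an arbitrary function of its
    disjointness [r], and combing lines may wander, points within [D] of a centre being displaced by
    up to some unspecified [sigma D]. So no single scale suffices. Concentric annuli use
    disjointness scales that grow outwards, and their radii are chosen after the diameters and the
    displacements, so as to dominate both. Growing scales make the pieces recede; growing radii make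
    them small, in the sense that combing moves points by at most about half of the distance from
    the centre to the base point. Durations and chains may then vary arbitrarily from one centre to
    the next, since they are shared by all points of one piece. *)

Lemma choice_fun {A B : Type} (P : A -> B -> Prop) :
  (forall x, exists y, P x y) -> exists f, forall x, P x (f x).
Proof.
  intro H. exists (fun x => proj1_sig (constructive_indefinite_description _ (H x))).
  intro x. exact (proj2_sig (constructive_indefinite_description _ (H x))).
Qed.

(** * Integer parts and bounded subsets of the half-line *)

Definition nfloor (t : R) : nat := Z.to_nat (Int_part t).

Lemma nfloor_spec (t : R) : 0 <= t -> INR (nfloor t) <= t < INR (nfloor t) + 1.
Proof.
  intro Ht. destruct (base_Int_part t) as [H1 H2]. unfold nfloor.
  assert (Hz : (0 <= Int_part t)%Z).
  { assert (-1 < Int_part t)%Z by (apply lt_IZR; lra). lia. }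
  rewrite INR_IZR_INZ, Z2Nat.id by exact Hz. lra.
Qed.

Lemma nfloor_INR (k : nat) : nfloor (INR k) = k.
Proof.
  destruct (nfloor_spec (INR k) (pos_INR k)) as [H1 H2].
  apply INR_le in H1. rewrite <- S_INR in H2. apply INR_lt in H2. lia.
Qed.

Lemma nfloor_lt (s t : R) : 0 <= s -> 0 <= t ->
  dnat (nfloor s) (nfloor t) < Rabs (s - t) + 1.
Proof.
  intros Hs Ht. pose proof (nfloor_spec s Hs). pose proof (nfloor_spec t Ht).
  unfold dnat. repeat (unfold Rabs; destruct Rcase_abs); lra.
Qed.

Definition rp (t : R) : Rplus := exist _ (Rmax 0 t) (Rmax_l 0 t).

Lemma rp_val (t : R) : 0 <= t -> proj1_sig (rp t) = t.
Proof. intro; apply Rmax_right; assumption. Qed.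

Lemma dnat_sub_le (m n l : nat) : dnat (m - l) (n - l) <= dnat m n.
Proof.
  unfold dnat.
  destruct (Nat.le_gt_cases l m); destruct (Nat.le_gt_cases l n).
  - rewrite !minus_INR by assumption. right; f_equal; ring.
  - replace (n - l)%nat with 0%nat by lia. rewrite minus_INR by assumption.
    apply le_INR in H. apply lt_INR in H0. simpl.
    repeat (unfold Rabs; destruct Rcase_abs); lra.
  - replace (m - l)%nat with 0%nat by lia. rewrite minus_INR by assumption.
    apply le_INR in H0. apply lt_INR in H. simpl.
    repeat (unfold Rabs; destruct Rcase_abs); lra.
  - replace (n - l)%nat with 0%nat by lia. replace (m - l)%nat with 0%nat by lia.
    rewrite Rminus_diag, Rabs_R0. apply Rabs_pos.
Qed.

Lemma dnat_between_l (m l n : nat) : (m <= l <= n)%nat -> dnat m l <= dnat m n.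
Proof.
  intros [H1 H2]. apply le_INR in H1, H2. unfold dnat.
  repeat (unfold Rabs; destruct Rcase_abs); lra.
Qed.

Lemma dnat_between_r (m l n : nat) : (n <= l <= m)%nat -> dnat l n <= dnat m n.
Proof.
  intros [H1 H2]. apply le_INR in H1, H2. unfold dnat.
  repeat (unfold Rabs; destruct Rcase_abs); lra.
Qed.

Lemma bounded_ball {X : Type} (d : X -> X -> R) (o : X) (B : X -> Prop) :
  is_metric d -> bounded d B -> exists r, forall x, B x -> d o x <= r.
Proof.
  intros (Hp & H0 & Hi & Hs & Ht) [r Hr].
  destruct (classic (exists y, B y)) as [[y Hy]|Hn].
  - exists (d o y + r). intros x Hx. specialize (Hr y x Hy Hx). pose proof (Ht o y x). lra.
  - exists 0. intros x Hx. exfalso; eauto.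
Qed.

Lemma ball_bounded {X : Type} (d : X -> X -> R) (o : X) (B : X -> Prop) r :
  is_metric d -> (forall x, B x -> d o x <= r) -> bounded d B.
Proof.
  intros (Hp & H0 & Hi & Hs & Ht) Hr. exists (r + r). intros x y Hx Hy.
  pose proof (Ht x o y). pose proof (Hr x Hx). pose proof (Hr y Hy).
  rewrite (Hs x o) in H. lra.
Qed.

Lemma dRp_metric : is_metric dRp.
Proof.
  unfold dRp. repeat split.
  - intros; apply Rabs_pos.
  - intros; rewrite Rminus_diag; apply Rabs_R0.
  - intros [x hx] [y hy]; simpl; intro H.
    assert (x = y) by (revert H; unfold Rabs; destruct Rcase_abs; lra).
    subst. f_equal. apply proof_irrelevance.
  - intros; apply Rabs_minus_sym.
  - intros x y z. repeat (unfold Rabs; destruct Rcase_abs); lra.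
Qed.

Lemma bounded_Rplus (B : Rplus -> Prop) :
  bounded dRp B -> exists r, forall t, B t -> proj1_sig t <= r.
Proof.
  intro HB. destruct (bounded_ball dRp (rp 0) B dRp_metric HB) as [r Hr].
  exists r. intros t Ht. specialize (Hr t Ht). unfold dRp in Hr.
  rewrite rp_val in Hr by lra. destruct t as [t ht]; simpl in *.
  revert Hr; unfold Rabs; destruct Rcase_abs; lra.
Qed.

(** A set which splits into pieces that recede from one another, each small
    compared with its distance to the base point, is contracted by combing every
    piece to its centre [c] and then moving the centre to the ray along [w]. *)
Lemma pieces_categorical {X : Type} (d : X -> X -> R) (o : X)
  (A : X -> Prop) (c : X -> X) (C : X -> X -> nat -> X) (alpha : Rplus -> X)
  (w : X -> nat -> X) (l : X -> nat) (K0 : R)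
  (Hd : is_metric d)
  (Hfin : forall (f : X -> R) r, exists M, forall x, d o x <= r -> f x <= M)
  (HC : is_bicombing d C)
  (Hsmall : forall x m, A x -> d (C (c x) x m) (c x) <= d o (c x) / 2 + K0)
  (Hsep : forall r, exists r', forall x y, A x -> A y -> d x y < r -> c x <> c y ->
            d o x <= r' /\ d o y <= r')
  (Halpha : coarse dRp d alpha)
  (w0 : forall p, w p 0%nat = alpha (rp (d o p)))
  (wend : forall p k, (l p <= k)%nat -> w p k = p)
  (wlip : forall p k k', d (w p k) (w p k') <= dnat k k')
  (wesc : forall r, exists r', forall p k, d o (w p k) <= r -> d o p <= r') :
  coarsely_categorical d A.
Proof.
  pose proof Hd as (Hpos & Hrefl & Hid & Hsym & Htri).
  destruct HC as (HCc & HC0 & HCp & HCe).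
  (* Once the combing has arrived at [x], the displacement bound [Hsmall] measures the distance from
     [x] to its centre. *)
  assert (Hpiece : forall x, A x -> d x (c x) <= d o (c x) / 2 + K0).
  { intros x Hx.
    destruct (HCe (c x) (fun y => y = x)) as [N HN].
    { exists 0. intros y z -> ->. rewrite Hrefl; lra. }
    rewrite <- (HN x N eq_refl (le_n N)) at 1. apply Hsmall; assumption. }
  (* The points with centre [p] form a bounded set by [Hpiece], so one arrival time serves the whole
     piece. *)
  assert (HN : exists N : X -> nat, forall p x n, A x -> c x = p -> (N p <= n)%nat -> C p x n = x).
  { apply (choice_fun (fun p N => forall x n, A x -> c x = p -> (N <= n)%nat -> C p x n = x)).
    intro p. destruct (HCe p (fun x => A x /\ c x = p)) as [N HN].
    - apply (ball_bounded d p _ (d o p / 2 + K0) Hd). intros x [Hx <-].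
      rewrite Hsym. auto.
    - exists N. intros; apply HN; auto. }
  destruct HN as [N HN].
  (* Chain, then combing; the last summand is waiting time, which gives [HL] and with it the
     properness of [q]. *)
  set (L := fun p => (l p + (N p + S (nfloor (d o p))))%nat).
  assert (HL : forall p, d o p <= INR (L p)).
  { intro p. pose proof (nfloor_spec (d o p) (Hpos o p)). unfold L.
    rewrite !plus_INR, S_INR. pose proof (pos_INR (l p)). pose proof (pos_INR (N p)). lra. }
  (* The chain ends and the combing starts at the centre, so the switch at time [l (c x)] creates no
     jump. *)
  set (K := fun x k => if (k <=? l (c x))%nat then w (c x) k else C (c x) x (k - l (c x))%nat).
  assert (HK1 : forall x k, (k <= l (c x))%nat -> K x k = w (c x) k).
  { intros x k Hk. unfold K. apply Nat.leb_le in Hk. rewrite Hk. reflexivity. }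
  assert (HK2 : forall x k, (l (c x) <= k)%nat -> K x k = C (c x) x (k - l (c x))%nat).
  { intros x k Hk. unfold K. destruct (Nat.leb_spec k (l (c x))); [|reflexivity].
    rewrite wend by lia. replace (k - l (c x))%nat with 0%nat by lia. rewrite HC0. reflexivity. }
  assert (Hcx : forall x, A x -> d o (c x) <= 2 * (d o x + K0)).
  { intros x Hx. pose proof (Hpiece x Hx). pose proof (Htri o x (c x)). lra. }
  assert (Hxc : forall x, A x -> d o x <= 3 / 2 * d o (c x) + K0).
  { intros x Hx. pose proof (Hpiece x Hx). pose proof (Htri o (c x) x).
    rewrite (Hsym (c x) x) in H0. lra. }
  set (q := fun x : subsp A => rp (INR (L (c (proj1_sig x))))).
  assert (Hq : forall x, proj1_sig (q x) = INR (L (c (proj1_sig x)))).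
  { intro x. unfold q. apply rp_val, pos_INR. }
  set (j := fun x : subsp A => rp (d o (c (proj1_sig x)))).
  assert (Hj : forall x, proj1_sig (j x) = d o (c (proj1_sig x))).
  { intro x. unfold j. apply rp_val, Hpos. }
  set (H := fun p : Iq q => K (proj1_sig (fst (proj1_sig p))) (nfloor (snd (proj1_sig p)))).
  (* Equal centres give equal values; close points with different centres lie in a ball depending
     only on [r], where [Hfin] bounds [f (c x)]. *)
  assert (Hpiecewise : forall f : X -> R, (forall x, 0 <= f (c x)) ->
    controlled (dsub d A) dRp (fun x => rp (f (c (proj1_sig x))))).
  { intros f Hf r Hr. destruct (Hsep r) as [r' Hr'].
    destruct (Hfin (fun x => f (c x)) r') as [M HM].
    exists (Rabs M + 1). split; [pose proof (Rabs_pos M); lra|].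
    intros [x Hx] [y Hy] Hxy. unfold dsub in Hxy. unfold dRp. simpl proj1_sig in *.
    rewrite !Rmax_right by apply Hf.
    destruct (classic (c x = c y)) as [->|Hne].
    - rewrite Rminus_diag, Rabs_R0. pose proof (Rabs_pos M); lra.
    - destruct (Hr' x y Hx Hy Hxy Hne) as [H1 H2].
      pose proof (HM x H1). pose proof (HM y H2). pose proof (Hf x). pose proof (Hf y).
      simpl in *. repeat (unfold Rabs; destruct Rcase_abs); lra. }
  exists alpha, j. split; [exact Halpha|]. split; [split|].
  - apply (Hpiecewise (fun p => d o p)). intros; apply Hpos.
  - intros B HB. destruct (bounded_Rplus B HB) as [r Hr].
    assert (Hb : bounded d (fun x => A x /\ d o (c x) <= r)).
    { apply (ball_bounded d o _ (3 / 2 * r + K0) Hd). intros x [Hx Hx'].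
      pose proof (Hxc x Hx). lra. }
    destruct Hb as [s Hs]. exists s. intros x y Hx Hy. apply Hs.
    + split; [apply proj2_sig|]. rewrite <- Hj. auto.
    + split; [apply proj2_sig|]. rewrite <- Hj. auto.
  - exists q. split; [split|].
    + apply (Hpiecewise (fun p => INR (L p))). intros; apply pos_INR.
    + intros B HB. destruct (bounded_Rplus B HB) as [r Hr].
      assert (Hb : bounded d (fun x => A x /\ d o (c x) <= r)).
      { apply (ball_bounded d o _ (3 / 2 * r + K0) Hd). intros x [Hx Hx'].
        pose proof (Hxc x Hx). lra. }
      destruct Hb as [s Hs]. exists s.
      assert (forall x, B (q x) -> d o (c (proj1_sig x)) <= r).
      { intros x Hx. specialize (Hr _ Hx). rewrite Hq in Hr.
        pose proof (HL (c (proj1_sig x))). lra. }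
      intros x y Hx Hy. apply Hs; (split; [apply proj2_sig|auto]).
    + exists H. split; [split|split].
      * intros r Hr. destruct (Hsep r) as [r' Hr'].
        destruct (HCc (r + 1)) as (S1 & HS1 & HS1'); [lra|].
        (* This function bounds the distance from [o] to [K x k] for all [k] at once: along the
           chain by [l (c x)] steps from the centre, during the combing by [Hsmall]. It settles
           close points with different centres. *)
        destruct (Hfin (fun x => 3 / 2 * d o (c x) + Rabs K0 + INR (l (c x))) r') as [M HM].
        exists (r + 1 + S1 + (Rabs M + Rabs M)).
        split; [pose proof (Rabs_pos M); lra|].
        intros [[[x Hx] s] Hs] [[[y Hy] t] Ht] Hxy. unfold dIq, dsub in Hxy.
        simpl in Hxy, Hs, Ht. unfold H; simpl.
        assert (Hxy1 : d x y < r) by (eapply Rle_lt_trans; [apply Rmax_l|exact Hxy]).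
        assert (Hst : Rabs (s - t) < r) by (eapply Rle_lt_trans; [apply Rmax_r|exact Hxy]).
        pose proof (nfloor_lt s t (proj1 Hs) (proj1 Ht)) as Hfl.
        set (m := nfloor s) in *. set (n := nfloor t) in *.
        destruct (classic (c x = c y)) as [Heq|Hne].
        (* Truncated subtraction stops the combing clock at 0 during the chain, so this estimate
           also serves the cases where only one of the two points has begun combing. *)
        -- assert (HCxy : d (C (c x) x (m - l (c x))%nat) (C (c y) y (n - l (c x))%nat) < S1).
           { apply (HS1' (c x, x, (m - l (c x))%nat) (c y, y, (n - l (c x))%nat)).
             unfold dXXN; simpl. rewrite <- Heq, Hrefl.
             pose proof (dnat_sub_le m n (l (c x))). pose proof (Hpos x y).
             apply Rmax_lub_lt; [apply Rmax_lub_lt|]; lra. }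
           pose proof (Rabs_pos M).
           destruct (Nat.le_gt_cases m (l (c x))) as [Hm|Hm];
             destruct (Nat.le_gt_cases n (l (c x))) as [Hn|Hn].
           ++ rewrite (HK1 x m Hm), (HK1 y n) by (rewrite <- Heq; exact Hn).
              rewrite <- Heq. pose proof (wlip (c x) m n). lra.
           ++ rewrite (HK1 x m Hm), (HK2 y n) by (rewrite <- Heq; lia).
              rewrite <- Heq in *.
              replace (m - l (c x))%nat with 0%nat in HCxy by lia. rewrite HC0 in HCxy.
              pose proof (Htri (w (c x) m) (c x) (C (c x) y (n - l (c x))%nat)).
              pose proof (wlip (c x) m (l (c x))) as Hw. rewrite (wend _ _ (le_n _)) in Hw.
              assert (dnat m (l (c x)) <= dnat m n).
              { apply dnat_between_l; lia. }
              lra.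
           ++ rewrite (HK2 x m), (HK1 y n) by (try rewrite <- Heq; lia).
              rewrite <- Heq in *.
              replace (n - l (c x))%nat with 0%nat in HCxy by lia. rewrite HC0 in HCxy.
              pose proof (Htri (C (c x) x (m - l (c x))%nat) (c x) (w (c x) n)).
              pose proof (wlip (c x) (l (c x)) n) as Hw. rewrite (wend _ _ (le_n _)) in Hw.
              assert (dnat (l (c x)) n <= dnat m n).
              { apply dnat_between_r; lia. }
              lra.
           ++ rewrite (HK2 x m), (HK2 y n) by (try rewrite <- Heq; lia).
              rewrite <- Heq in *. lra.
        -- destruct (Hr' x y Hx Hy Hxy1 Hne) as [H1 H2].
           assert (HKb : forall x k, A x -> d o x <= r' -> d o (K x k) <= Rabs M).
           { intros z k Hz Hz'. specialize (HM z Hz'). simpl in HM.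
             apply Rle_trans with M; [|apply Rle_abs].
             pose proof (Rle_abs K0). pose proof (Hpos o (c z)). pose proof (Rabs_pos K0).
             pose proof (pos_INR (l (c z))).
             destruct (Nat.le_gt_cases k (l (c z))) as [Hk|Hk].
             - rewrite HK1 by exact Hk. pose proof (Htri o (c z) (w (c z) k)).
               pose proof (wlip (c z) (l (c z)) k) as Hw. rewrite (wend _ _ (le_n _)) in Hw.
               unfold dnat in Hw. apply le_INR in Hk. pose proof (pos_INR k).
               rewrite Rabs_right in Hw by lra. lra.
             - rewrite HK2 by lia. pose proof (Hsmall z (k - l (c z))%nat Hz).
               pose proof (Htri o (c z) (C (c z) z (k - l (c z))%nat)).
               rewrite (Hsym (c z)) in H7. lra. }
           pose proof (HKb x m Hx H1). pose proof (HKb y n Hy H2).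
           pose proof (Htri (K x m) o (K y n)). rewrite (Hsym (K x m) o) in H4. lra.
      * intros B HB. destruct (bounded_ball d o B Hd HB) as [r Hr].
        destruct (wesc r) as [r1 Hr1].
        (* During the combing the distance to [o] is at least [d o (c x) / 2 - K0], whence
           [2 * (r + K0)]; during the chain [wesc] gives [r1]. *)
        set (r2 := Rmax r1 (2 * (r + K0))).
        assert (Hc : forall x k, A x -> B (K x k) -> d o (c x) <= r2).
        { intros x k Hx Hk. specialize (Hr _ Hk).
          destruct (Nat.le_gt_cases k (l (c x))) as [Hkl|Hkl].
          - rewrite HK1 in Hr by exact Hkl. apply Rle_trans with r1; [eauto|apply Rmax_l].
          - rewrite HK2 in Hr by lia. eapply Rle_trans; [|apply Rmax_r].
            pose proof (Hsmall x (k - l (c x))%nat Hx).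
            pose proof (Htri o (C (c x) x (k - l (c x))%nat) (c x)). lra. }
        destruct (Hfin (fun p => INR (L p)) r2) as [M HM].
        exists (Rmax (2 * (3 / 2 * r2 + K0)) M).
        intros [[[x Hx] s] Hs] [[[y Hy] t] Ht] Hbx Hby. unfold H in Hbx, Hby. simpl in *.
        unfold dIq, dsub; simpl.
        pose proof (Hc _ _ Hx Hbx) as Hc1. pose proof (Hc _ _ Hy Hby) as Hc2.
        apply Rmax_lub.
        -- eapply Rle_trans; [|apply Rmax_l].
           pose proof (Hxc x Hx). pose proof (Hxc y Hy). pose proof (Htri x o y).
           rewrite (Hsym x o) in H2. lra.
        -- eapply Rle_trans; [|apply Rmax_r].
           pose proof (HM _ Hc1). pose proof (HM _ Hc2). simpl in *.
           rewrite Rmax_right in Hs, Ht by apply pos_INR.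
           repeat (unfold Rabs; destruct Rcase_abs); lra.
      * intros [x Hx]. unfold H, i0; simpl.
        replace (nfloor 0) with 0%nat by (symmetry; apply (nfloor_INR 0)).
        rewrite HK1 by lia. apply w0.
      * intros [x Hx]. unfold H, i1; simpl fst; simpl snd; simpl proj1_sig.
        rewrite Rmax_right by apply pos_INR. rewrite nfloor_INR.
        rewrite HK2 by (unfold L; lia). apply HN; auto. unfold L; lia.
Qed.

(** * Covers by receding pieces *)

(** [E i] is the partial equivalence relation "lying in the same member of the
    family of colour [i]". *)
Definition coloured_partition {X : Type} (d : X -> X -> R) (n : nat) (r B : R)
  (E : nat -> X -> X -> Prop) : Prop :=
  (forall i x y, E i x y -> E i y x) /\
  (forall i x y z, E i x y -> E i y z -> E i x z) /\
  (forall x, exists i, (i <= n)%nat /\ E i x x) /\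
  (forall i x y, E i x x -> E i y y -> d x y <= r -> E i x y) /\
  (forall i x y, E i x y -> d x y <= B).

Lemma finite_bound (P : nat -> R -> Prop) (n : nat) :
  (forall i a b, P i a -> a <= b -> P i b) ->
  (forall i, (i <= n)%nat -> exists B, P i B) ->
  exists B, 0 <= B /\ forall i, (i <= n)%nat -> P i B.
Proof.
  intro Hmon. induction n as [|n IH]; intro H.
  - destruct (H 0%nat (le_n _)) as [B HB]. exists (Rmax 0 B). split; [apply Rmax_l|].
    intros i Hi. replace i with 0%nat by lia. apply (Hmon _ B); [exact HB|apply Rmax_r].
  - destruct IH as (B & HB0 & HB); [intros; apply H; lia|].
    destruct (H (S n) (le_n _)) as [B' HB']. exists (Rmax B B').
    split; [eapply Rle_trans; [exact HB0|apply Rmax_l]|]. intros i Hi.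
    destruct (Nat.eq_dec i (S n)) as [->|Hne].
    + apply (Hmon _ B'); [exact HB'|apply Rmax_r].
    + apply (Hmon _ B); [apply HB; lia|apply Rmax_l].
Qed.

(** As [r] is nonnegative, two members of one family that share a point are at distance 0 and hence
    equal; this makes lying in a common member transitive. *)
Lemma asdim_partition {X : Type} (d : X -> X -> R) (n : nat) (r : R) :
  is_metric d -> asdim_le d n -> 0 <= r ->
  exists E B, 0 <= B /\ coloured_partition d n r B E.
Proof.
  intros (Hpos & Hrefl & Hid & Hsym & Htri) Has Hr. destruct (Has r) as (Fam & HF & Hcov).
  destruct (finite_bound (fun i B => forall U, Fam i U -> forall x y, U x -> U y -> d x y <= B) n)
    as (B & HB0 & HB).
  { intros i a b Ha Hab U HU x y Hx Hy. specialize (Ha U HU x y Hx Hy). lra. }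
  { intros i Hi. destruct (HF i Hi) as [_ [B HB]]. exists B. exact HB. }
  (* Nothing is known about [Fam i] for [i > n]; the first conjunct empties the relation there. *)
  exists (fun i x y => (i <= n)%nat /\ exists U, Fam i U /\ U x /\ U y), B.
  split; [exact HB0|].
  assert (Huniq : forall i U V x y, (i <= n)%nat -> Fam i U -> Fam i V -> U x -> V y ->
            d x y <= r -> U = V).
  { intros i U V x y Hi HU HV Hx Hy Hxy. apply NNPP. intro Hne.
    pose proof (proj1 (HF i Hi) U V HU HV Hne x y Hx Hy). lra. }
  repeat split.
  - apply H.
  - destruct H as (_ & U & HU & Hx & Hy). exists U; auto.
  - apply H.
  - destruct H as (Hi & U & HU & Hx & Hy). destruct H0 as (_ & V & HV & Hy' & Hz).
    assert (U = V) by (apply (Huniq i U V y y); auto; rewrite Hrefl; exact Hr).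
    subst. exists V; auto.
  - intro x. destruct (Hcov x) as (i & U & Hi & HU & Hx). exists i. split; [exact Hi|].
    split; [exact Hi|]. exists U; auto.
  - apply H.
  - destruct H as (Hi & U & HU & Hx & _). destruct H0 as (_ & V & HV & Hy & _).
    assert (U = V) by (apply (Huniq i U V x y); auto). subst. exists V; auto.
  - intros i x y (Hi & U & HU & Hx & Hy). eapply HB; eauto.
Qed.

(** Here [beta r] stands for the diameter bound of a cover of disjointness [r]. The next scale
    exceeds the diameter of a group of annulus [k] plus a margin [scale beta k] on both sides, so
    such a group is that close to at most one group of the same colour in the next annulus. *)
Fixpoint scale (beta : R -> R) (k : nat) : R :=
  match k with
  | O => 1
  | S k' => 2 * scale beta k' + beta (scale beta k') + 1
  end.

(** Inner radii of the annuli. The scale and diameter terms make an annulus too wide for two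
    successive merges or for a link that skips it; the [sigma] term makes the displacement of a
    piece centred in annulus [S k] at most half of the distance from the centre to the base
    point. *)
Fixpoint radius (beta sigma : R -> R) (k : nat) : R :=
  match k with
  | O => 0
  | S k' => radius beta sigma k' + scale beta k' + scale beta k + beta (scale beta k)
            + 2 * sigma (scale beta k + beta (scale beta k)) + 1
  end.

(** Consequently only finitely many annuli have a scale below a given [r], so points closer than [r]
    can have different centres only inside a ball. *)
Lemma scale_ge (beta : R -> R) (k : nat) :
  (forall r, 0 <= beta r) -> INR k + 1 <= scale beta k.
Proof.
  intro Hb. induction k as [|k IH]; [simpl; lra|].
  rewrite S_INR. simpl scale. pose proof (Hb (scale beta k)). pose proof (pos_INR k). lra.
Qed.

Lemma radius_step (beta sigma : R -> R) (k : nat) :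
  radius beta sigma k + scale beta k + scale beta (S k) + beta (scale beta (S k))
    + 2 * sigma (scale beta (S k) + beta (scale beta (S k))) + 1
  = radius beta sigma (S k).
Proof. reflexivity. Qed.

Lemma radius_mono (beta sigma : R -> R) (k l : nat) :
  (forall r, 0 <= beta r) -> (forall r, 0 <= sigma r) -> (k <= l)%nat ->
  radius beta sigma k <= radius beta sigma l.
Proof.
  intros Hb Hs Hkl. induction Hkl as [|l Hkl IH]; [lra|].
  pose proof (radius_step beta sigma l).
  pose proof (scale_ge beta l Hb). pose proof (scale_ge beta (S l) Hb).
  pose proof (pos_INR l). pose proof (pos_INR (S l)).
  pose proof (Hb (scale beta (S l))).
  pose proof (Hs (scale beta (S l) + beta (scale beta (S l)))). lra.
Qed.

Lemma radius_ge (beta sigma : R -> R) (k : nat) :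
  (forall r, 0 <= beta r) -> (forall r, 0 <= sigma r) -> INR k <= radius beta sigma k.
Proof.
  intros Hb Hs. induction k as [|k IH]; [simpl; lra|].
  pose proof (radius_step beta sigma k).
  pose proof (scale_ge beta k Hb). pose proof (scale_ge beta (S k) Hb).
  pose proof (pos_INR k). pose proof (pos_INR (S k)).
  pose proof (Hb (scale beta (S k))).
  pose proof (Hs (scale beta (S k) + beta (scale beta (S k)))). rewrite S_INR in *. lra.
Qed.

Lemma annulus (a : nat -> R) (t : R) (N : nat) :
  a 0%nat <= t -> t < a N -> exists k, a k <= t < a (S k).
Proof.
  intro H0. induction N as [|N IH]; intro HN; [lra|].
  destruct (Rlt_le_dec t (a N)); [auto|]. exists N; lra.
Qed.

(** Points of the annulus of index [k] are grouped by a cover of disjointness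
    [scale k]; a group meeting the [scale k]-neighbourhood of a group of the next
    annulus is merged with it.  Since [scale] and [radius] grow fast enough, it
    meets at most one such group, and that group is not itself merged outwards. *)
Lemma spread_cover {X : Type} (d : X -> X -> R) (o : X) (n : nat) (sigma : R -> R) :
  is_metric d -> asdim_le d n -> (forall r, 0 <= sigma r) ->
  exists (A : nat -> X -> Prop) (c : nat -> X -> X) (K0 : R),
    (forall x, exists i, (i <= n)%nat /\ A i x) /\
    (forall i r, exists r', forall x y, A i x -> A i y -> d x y < r -> c i x <> c i y ->
       d o x <= r' /\ d o y <= r') /\
    (forall i x, A i x -> exists D, d x (c i x) <= D /\ 2 * sigma D <= d o (c i x) + K0).
Proof.
  intros Hd Has Hs0. pose proof Hd as (Hpos & Hrefl & Hid & Hsym & Htri).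
  assert (Hch : exists EB : R -> (nat -> X -> X -> Prop) * R, forall r,
            0 <= snd (EB r) /\ (0 <= r -> coloured_partition d n r (snd (EB r)) (fst (EB r)))).
  { apply (choice_fun (fun r EB => 0 <= snd EB /\ (0 <= r ->
             coloured_partition d n r (snd EB) (fst EB)))).
    intro r. destruct (Rle_lt_dec 0 r) as [Hr|Hr].
    - destruct (asdim_partition d n r Hd Has Hr) as (E & B & HB & HE). exists (E, B); auto.
    (* A dummy value for negative [r] keeps [beta] total and nonnegative; the scales are at least 1
       and never reach it. *)
    - exists (fun _ _ _ => False, 0). simpl. split; [lra|]. intro; lra. }
  destruct Hch as [EB HEB].
  set (beta := fun r => snd (EB r)).
  assert (Hb : forall r, 0 <= beta r) by (intro r; apply HEB).
  set (rr := scale beta). set (RR := radius beta sigma).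
  set (E := fun k => fst (EB (rr k))). set (B := fun k => beta (rr k)).
  assert (Hrr : forall k, INR k + 1 <= rr k) by (intro; apply scale_ge; exact Hb).
  assert (Hrr1 : forall k, 1 <= rr k) by (intro k; pose proof (Hrr k); pose proof (pos_INR k); lra).
  assert (HB : forall k, 0 <= B k) by (intro; apply Hb).
  assert (HrrS : forall k, rr (S k) = 2 * rr k + B k + 1) by reflexivity.
  assert (HRRS : forall k, RR (S k) = RR k + rr k + rr (S k) + B (S k)
            + 2 * sigma (rr (S k) + B (S k)) + 1) by reflexivity.
  assert (HRRmono : forall k l, (k <= l)%nat -> RR k <= RR l)
    by (intros; apply radius_mono; assumption).
  assert (HE : forall k, coloured_partition d n (rr k) (B k) (E k)).
  { intro k. apply HEB. pose proof (Hrr1 k); lra. }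
  assert (Hlv : exists lv : X -> nat, forall x, RR (lv x) <= d o x < RR (S (lv x))).
  { apply (choice_fun (fun x k => RR k <= d o x < RR (S k))). intro x.
    apply (annulus RR _ (S (nfloor (d o x)))); [apply Hpos|].
    eapply Rlt_le_trans; [|apply radius_ge; assumption]. rewrite S_INR.
    apply nfloor_spec, Hpos. }
  destruct Hlv as [lv Hlv].
  (* Where the centre of [x] may lie: [P] collects the points of the outer group into which the
     group of [x] is merged, and [L] falls back on the group of [x] within its own annulus when
     there is none. *)
  set (P := fun i x z => exists x' y, E (lv x) i x x' /\ lv x' = lv x /\ lv y = S (lv x) /\
              d x' y <= rr (lv x) /\ E (lv y) i y z /\ lv z = lv y).
  set (L := fun i x z => P i x z \/ ((~ exists z', P i x z') /\ E (lv x) i x z /\ lv z = lv x)).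
  set (A := fun i x => E (lv x) i x x).
  set (c := fun i x => epsilon (inhabits o) (L i x)).
  assert (Hc : forall i x, A i x -> L i x (c i x)).
  { intros i x Hx. apply epsilon_spec.
    destruct (classic (exists z, P i x z)) as [[z Hz]|Hn].
    - exists z. left; exact Hz.
    - exists x. right. auto. }
  assert (Hclose : forall i x y, A i x -> A i y -> (lv x <= lv y)%nat ->
            d x y <= rr (lv x) -> c i x = c i y).
  { intros i x y Hx Hy Hl Hxy.
    (* [epsilon] is applied to the predicate itself, so extensionally equal predicates yield the
       very same centre. *)
    enough (HL : L i x = L i y) by (unfold c; rewrite HL; reflexivity).
    destruct (Hlv x) as [Hx1 Hx2]. destruct (Hlv y) as [Hy1 Hy2].
    destruct (HE (lv x)) as (Es & Et & Ec & Ej & Eb).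
    pose proof (Htri o x y) as Hoxy.
    assert (Hcase : lv y = lv x \/ lv y = S (lv x) \/ (S (S (lv x)) <= lv y)%nat) by lia.
    destruct Hcase as [Heq|[Heq|Hge]].
    - unfold A in Hy. rewrite Heq in Hy. pose proof (Ej i x y Hx Hy Hxy) as Exy.
      assert (HP : forall z, P i x z <-> P i y z).
      { intro z; unfold P; rewrite Heq.
        split; intros (x' & y' & H1 & H2); exists x', y'; (split; [eauto|exact H2]). }
      extensionality z. apply propositional_extensionality. unfold L. rewrite Heq.
      split; (intros [H|(H1 & H2 & H3)]; [left; apply HP; exact H|right]);
        (split; [intros [z' Hz']; apply H1; exists z'; apply HP; exact Hz'|split; [eauto|exact H3]]).
    - destruct (HE (lv y)) as (Fs & Ft & Fc & Fj & Fb).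
      (* Any outer group reached from the group of [x] comes within [2 * rr (lv x) + B (lv x)] of
         [y]. This is below the scale of the next annulus, so it is the group of [y]. *)
      assert (HPx : forall z, P i x z <-> (E (lv y) i y z /\ lv z = lv y)).
      { intro z. split.
        - intros (x' & y' & H1 & H2 & H3 & H4 & H5 & H6).
          rewrite H3, <- Heq in H5. split; [|congruence].
          apply (Ft i y y' z); [|exact H5]. apply Fj; [exact Hy|eauto|].
          pose proof (Eb i x x' H1). pose proof (Htri y x x'). pose proof (Htri y x' y').
          rewrite (Hsym y x) in *. rewrite Heq, HrrS. lra.
        - intros [H1 H2]. exists x, y. unfold A in *. auto 10. }
      (* The group of [y] has a point within [rr (lv x)] of [x], and the annulus of [y] is wider
         than the diameter of that group plus both scales, so the group cannot come close to the
         annulus beyond. *)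
      assert (HPy : ~ exists z, P i y z).
      { intros (z & y' & u & H1 & H2 & H3 & H4 & _).
        pose proof (proj1 (Hlv u)) as Hu. rewrite H3, Heq in Hu.
        pose proof (Fb i y y' H1) as Hyy'. rewrite Heq in Hyy', H4.
        pose proof (Htri o y y'). pose proof (Htri o y' u).
        rewrite (HRRS (S (lv x))) in Hu. pose proof (HrrS (lv x)). pose proof (HrrS (S (lv x))).
        pose proof (Hrr1 (lv x)). pose proof (HB (lv x)). pose proof (HB (S (S (lv x)))).
        pose proof (Hs0 (rr (S (S (lv x))) + B (S (S (lv x))))). lra. }
      extensionality z. apply propositional_extensionality. unfold L. split.
      + intros [H|(H & _)]; [right; split; [exact HPy|apply HPx; exact H]|].
        exfalso. apply H. exists y. apply HPx. auto.
      + intros [H|(_ & H)]; [exfalso; eauto|left; apply HPx; exact H].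
    - exfalso. pose proof (HRRmono _ _ Hge) as Hm. rewrite (HRRS (S (lv x))) in Hm.
      pose proof (HrrS (lv x)). pose proof (Hrr1 (lv x)). pose proof (HB (lv x)).
      pose proof (Hrr1 (S (S (lv x)))).
      pose proof (HB (S (S (lv x)))). pose proof (Hs0 (rr (S (S (lv x))) + B (S (S (lv x))))). lra. }
  assert (Hnear : forall x y r N, r <= INR N -> (lv x <= lv y)%nat -> ~ d x y <= rr (lv x) ->
            d x y < r -> d o x <= RR N + Rabs r /\ d o y <= RR N + Rabs r).
  { intros x y r N HN Hl Hxy Hr. apply Rnot_le_lt in Hxy.
    assert (HlN : (S (lv x) <= N)%nat).
    { apply INR_le. rewrite S_INR. pose proof (Hrr (lv x)). lra. }
    pose proof (HRRmono _ _ HlN). pose proof (proj2 (Hlv x)). pose proof (Htri o x y).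
    pose proof (Rle_abs r). pose proof (Rabs_pos r). lra. }
  (* Annulus 0 has inner radius 0, which dominates no displacement; the constant covers the centres
     lying there. *)
  exists A, c, (2 * sigma (rr 0%nat + B 0%nat)). split; [|split].
  - intro x. destruct (HE (lv x)) as (_ & _ & Ec & _). apply Ec.
  - intros i r. set (N := S (nfloor (Rabs r))).
    assert (HN : r <= INR N).
    { unfold N. rewrite S_INR. pose proof (nfloor_spec (Rabs r) (Rabs_pos r)).
      pose proof (Rle_abs r). lra. }
    exists (RR N + Rabs r). intros x y Hx Hy Hxy Hne.
    destruct (Nat.le_ge_cases (lv x) (lv y)) as [Hl|Hl].
    + apply (Hnear x y r N HN Hl); [|exact Hxy]. intro H. apply Hne. auto.
    + apply and_comm. rewrite Hsym in Hxy. apply (Hnear y x r N HN Hl); [|exact Hxy].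
      intro H. apply Hne. symmetry. auto.
  - intros i x Hx. set (z := c i x). pose proof (Hc i x Hx) as HL. fold z in HL.
    (* [D] is taken at the level of the centre, not of [x]: after a merge, the inner diameter and
       the gap are absorbed by [rr (lv z)] through the recursion of [scale]. *)
    exists (rr (lv z) + B (lv z)). destruct (HE (lv x)) as (Es & Et & Ec & Ej & Eb). split.
    + destruct HL as [(x' & y & H1 & H2 & H3 & H4 & H5 & H6)|(_ & H1 & H2)].
      * destruct (HE (lv y)) as (_ & _ & _ & _ & Fb).
        pose proof (Eb i x x' H1). pose proof (Fb i y z H5).
        pose proof (Htri x x' y). pose proof (Htri x y z).
        rewrite H6. rewrite H3 in *. rewrite HrrS. pose proof (Hrr1 (lv x)). lra.
      * rewrite H2. pose proof (Eb i x z H1). pose proof (Hrr1 (lv x)). lra.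
    + pose proof (proj1 (Hlv z)) as Hz.
      pose proof (Hs0 (rr 0%nat + B 0%nat)).
      destruct (lv z) as [|k].
      * unfold RR in Hz; simpl in Hz. lra.
      * rewrite HRRS in Hz. pose proof (HRRmono 0%nat k (Nat.le_0_l _)) as H0.
        change (RR 0%nat) with 0 in H0.
        pose proof (Hrr1 k). pose proof (Hrr1 (S k)). pose proof (HB (S k)). lra.
Qed.

(** * Coarse invariance *)

Lemma coarse_comp {T U V : Type} dT dU dV (f : T -> U) (g : U -> V) :
  coarse dT dU f -> coarse dU dV g -> coarse dT dV (fun x => g (f x)).
Proof.
  intros [Hf1 Hf2] [Hg1 Hg2]. split.
  - intros r Hr. destruct (Hf1 r Hr) as (s & Hs & H). destruct (Hg1 s Hs) as (t & Ht & H').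
    exists t; auto.
  - intros B HB. exact (Hf2 _ (Hg2 _ HB)).
Qed.

Lemma coarse_close {T U : Type} dT dU (f g : T -> U) (D : R) :
  is_metric dU -> (forall x, dU (f x) (g x) <= D) -> coarse dT dU f -> coarse dT dU g.
Proof.
  intros Hd HD [Hf1 Hf2]. pose proof Hd as (Hpos & Hrefl & Hid & Hsym & Htri).
  assert (HD' : forall x, dU (f x) (g x) <= Rabs D).
  { intro x. eapply Rle_trans; [apply HD|apply Rle_abs]. }
  split.
  - intros r Hr. destruct (Hf1 r Hr) as (s & Hs & H). exists (s + 2 * Rabs D).
    split; [pose proof (Rabs_pos D); lra|]. intros x y Hxy. specialize (H x y Hxy).
    pose proof (HD' x). pose proof (HD' y). pose proof (Htri (g x) (f x) (g y)).
    pose proof (Htri (f x) (f y) (g y)). rewrite (Hsym (g x) (f x)) in H2. lra.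
  - intros B [b Hb].
    destruct (Hf2 (fun u => exists v, B v /\ dU u v <= Rabs D)) as [s Hs].
    + exists (b + 2 * Rabs D). intros u u' (v & Hv & Huv) (v' & Hv' & Huv').
      specialize (Hb v v' Hv Hv'). pose proof (Htri u v u'). pose proof (Htri v v' u').
      rewrite (Hsym v' u') in H0. lra.
    + exists s. intros x y Hx Hy. apply Hs; eauto.
Qed.

(** The transported homotopy ends at [psi (phi x)], which is only close to [x]. The cylinder is
    therefore lengthened by 1, and the additional collar carries [x] itself; the result is close to
    a coarse map, hence coarse. *)
Lemma categorical_pullback {X Y : Type} dX dY (phi : X -> Y) (psi : Y -> X) (D : R)
  (A : Y -> Prop) :
  is_metric dX -> coarse dX dY phi -> coarse dY dX psi ->
  (forall x, dX (psi (phi x)) x <= D) ->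
  coarsely_categorical dY A -> coarsely_categorical dX (fun x => A (phi x)).
Proof.
  intros HdX Hphi Hpsi HD (alpha & j & Halpha & Hj & q & Hq & H & HH & H0 & H1).
  set (A' := fun x => A (phi x)).
  set (ph := fun x : subsp A' => exist A (phi (proj1_sig x)) (proj2_sig x) : subsp A).
  assert (Hph : coarse (dsub dX A') (dsub dY A) ph).
  { split.
    - intros r Hr. destruct (proj1 Hphi r Hr) as (s & Hs & HS). exists s. split; [exact Hs|].
      intros x y Hxy. apply HS. exact Hxy.
    - intros B [b Hb].
      destruct (proj2 Hphi (fun y => exists a, B a /\ proj1_sig a = y)) as [r Hr].
      { exists b. intros x y (u & Hu & <-) (v & Hv & <-). apply (Hb u v Hu Hv). }
      exists r. intros x y Hx Hy. apply Hr; [exists (ph x)|exists (ph y)]; auto. }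
  set (q' := fun x => rp (proj1_sig (q (ph x)) + 1)).
  assert (Hq' : forall x, proj1_sig (q' x) = proj1_sig (q (ph x)) + 1).
  { intro x. apply rp_val. pose proof (proj2_sig (q (ph x))). simpl in *. lra. }
  exists (fun t => psi (alpha t)), (fun x => j (ph x)).
  split; [exact (coarse_comp _ _ _ _ _ Halpha Hpsi)|].
  split; [exact (coarse_comp _ _ _ _ _ Hph Hj)|].
  exists q'. split.
  { apply (coarse_close _ _ (fun x => q (ph x)) q' 1 dRp_metric).
    - intro x. unfold dRp. rewrite Hq'. unfold Rabs; destruct Rcase_abs; lra.
    - exact (coarse_comp _ _ _ _ _ Hph Hq). }
  assert (Hcl : forall x s, 0 <= s ->
            0 <= snd (ph x, Rmin s (proj1_sig (q (ph x))))
              <= proj1_sig (q (fst (ph x, Rmin s (proj1_sig (q (ph x))))))).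
  { intros x s Hs. simpl. split; [|apply Rmin_r].
    apply Rmin_glb; [exact Hs|apply (proj2_sig (q (ph x)))]. }
  set (cl := fun p : Iq q' => exist _ (ph (fst (proj1_sig p)),
                Rmin (snd (proj1_sig p)) (proj1_sig (q (ph (fst (proj1_sig p))))))
                (Hcl (fst (proj1_sig p)) (snd (proj1_sig p)) (proj1 (proj2_sig p))) : Iq q).
  assert (Hclc : coarse (dIq (dsub dX A') q') (dIq (dsub dY A) q) cl).
  { split.
    - intros r Hr. destruct (proj1 Hph r Hr) as (s & Hs & HS).
      destruct (proj1 Hq s Hs) as (t & Ht & HT).
      exists (s + (r + t)). split; [lra|].
      intros [[x u] Hu] [[y v] Hv] Hxy. unfold dIq in *. simpl in *.
      assert (Hxy1 : dsub dX A' x y < r) by (eapply Rle_lt_trans; [apply Rmax_l|exact Hxy]).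
      assert (Hxy2 : Rabs (u - v) < r) by (eapply Rle_lt_trans; [apply Rmax_r|exact Hxy]).
      specialize (HS x y Hxy1). specialize (HT _ _ HS). unfold dRp in HT.
      apply Rmax_lub_lt; [lra|].
      revert Hxy2 HT. unfold Rmin.
      destruct (Rle_dec u (proj1_sig (q (ph x)))); destruct (Rle_dec v (proj1_sig (q (ph y))));
      repeat (unfold Rabs; destruct Rcase_abs); lra.
    - intros B [b Hb].
      destruct (proj2 Hph (fun y => exists a, B a /\ fst (proj1_sig a) = y)) as [r Hr].
      { exists b. intros x y (a & Ha & <-) (a' & Ha' & <-).
        eapply Rle_trans; [apply Rmax_l|apply (Hb a a' Ha Ha')]. }
      (* Clamping shortens a time by at most 1. *)
      exists (Rmax r (b + 1)).
      intros [[x u] Hu] [[y v] Hv] Hx Hy. unfold dIq. simpl fst; simpl snd; simpl proj1_sig.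
      apply Rmax_lub.
      + eapply Rle_trans; [|apply Rmax_l]. apply Hr; [exists (cl (exist _ (x,u) Hu))|
          exists (cl (exist _ (y,v) Hv))]; auto.
      + eapply Rle_trans; [|apply Rmax_r].
        pose proof (Hb _ _ Hx Hy) as Hxy. unfold dIq in Hxy. 
        pose proof (Rle_trans _ _ _ (Rmax_r _ _) Hxy) as Hxy'. simpl in Hxy', Hu, Hv.
        pose proof (Hq' x) as Hqx. pose proof (Hq' y) as Hqy. simpl in Hqx, Hqy.
        clear - Hxy' Hu Hv Hqx Hqy. revert Hxy'. unfold Rmin.
        destruct (Rle_dec u (proj1_sig (q (ph x)))); destruct (Rle_dec v (proj1_sig (q (ph y))));
        repeat (unfold Rabs; destruct Rcase_abs); lra. }
  set (H' := fun p : Iq q' =>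
         if Rle_dec (snd (proj1_sig p)) (proj1_sig (q (ph (fst (proj1_sig p)))))
         then psi (H (cl p)) else proj1_sig (fst (proj1_sig p))).
  exists H'. split; [|split].
  - apply (coarse_close _ _ (fun p => psi (H (cl p))) H' (Rabs D) HdX).
    + intros [[x s] Hs]. unfold H'; simpl fst; simpl snd; simpl proj1_sig.
      destruct Rle_dec as [Hle|Hgt].
      * destruct HdX as (_ & Hrefl & _). rewrite Hrefl. apply Rabs_pos.
      (* On the collar the clamped point is the end [i1], where the old homotopy gives [phi x]. *)
      * match goal with |- context [cl ?p] => assert (Hi : cl p = i1 q (ph x)) end.
        { unfold cl, i1. apply eq_sig_hprop; [intros; apply proof_irrelevance|]. simpl.
          f_equal. apply Rmin_right. lra. }
        rewrite Hi, H1. eapply Rle_trans; [apply HD|apply Rle_abs].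
    + exact (coarse_comp _ _ _ _ _ (coarse_comp _ _ _ _ _ Hclc HH) Hpsi).
  - intro x. unfold H'; simpl fst; simpl snd; simpl proj1_sig.
    destruct Rle_dec as [Hle|Hgt]; [|exfalso; apply Hgt; apply (proj2_sig (q (ph x)))].
    assert (Hi : cl (i0 q' x) = i0 q (ph x)).
    { unfold cl, i0. apply eq_sig_hprop; [intros; apply proof_irrelevance|]. simpl.
      f_equal. apply Rmin_left. exact Hle. }
    rewrite Hi, H0. reflexivity.
  - intro x. unfold H'. simpl fst; simpl snd.
    change (proj1_sig (i1 q' x)) with (x, proj1_sig (q' x)). simpl fst; simpl snd.
    destruct Rle_dec as [Hle|Hgt]; [|reflexivity]. exfalso. pose proof (Hq' x). simpl in *. lra.
Qed.

Lemma compact_bounded {X : Type} (d : X -> X -> R) (o : X) (K : X -> Prop) :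
  is_metric d -> compact_set d K -> exists r, forall x, K x -> d o x <= r.
Proof.
  intros (Hpos & Hrefl & Hid & Hsym & Htri) HK. apply NNPP. intro Hn.
  assert (Hu : exists u : nat -> X, forall n, K (u n) /\ INR n < d o (u n)).
  { apply (choice_fun (fun n x => K x /\ INR n < d o x)). intro n. apply NNPP. intro Hn'.
    apply Hn. exists (INR n). intros x Hx. apply Rnot_lt_le. intro. apply Hn'. eauto. }
  destruct Hu as [u Hu]. destruct (HK u) as (f & x & Hf & Hx & Hc); [intro; apply Hu|].
  destruct (Hc 1) as [N HN]; [lra|].
  assert (Hfn : forall n, (n <= f n)%nat).
  { induction n; [lia|]. pose proof (Hf n). lia. }
  set (n := max N (S (nfloor (d o x + 1)))).
  specialize (HN n (Nat.le_max_l _ _)). pose proof (proj2 (Hu (f n))) as Hun.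
  assert (Hle : INR (S (nfloor (d o x + 1))) <= INR (f n)).
  { apply le_INR. eapply Nat.le_trans; [apply Nat.le_max_r|apply Hfn]. }
  rewrite S_INR in Hle. pose proof (nfloor_spec (d o x + 1)).
  pose proof (Hpos o x). pose proof (Htri o x (u (f n))). rewrite (Hsym x (u (f n))) in H1. lra.
Qed.

(** * Word metrics *)

Section WordMetric.

Variables (G : Type) (mul : G -> G -> G) (inv : G -> G) (e : G).
Hypothesis Hassoc : forall x y z, mul x (mul y z) = mul (mul x y) z.
Hypothesis Hidl : forall x, mul e x = x.
Hypothesis Hinvl : forall x, mul (inv x) x = e.

Lemma mul_inv_r x : mul x (inv x) = e.
Proof.
  rewrite <- (Hidl (mul x (inv x))). rewrite <- (Hinvl (inv x)) at 1.
  rewrite <- Hassoc, (Hassoc (inv x) x), Hinvl, Hidl. apply Hinvl.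
Qed.

Lemma mul_id_r x : mul x e = x.
Proof. rewrite <- (Hinvl x), Hassoc, mul_inv_r. apply Hidl. Qed.

Lemma mul_cancel_l x y z : mul x y = mul x z -> y = z.
Proof.
  intro H. rewrite <- (Hidl y), <- (Hidl z), <- (Hinvl x), <- !Hassoc, H. reflexivity.
Qed.

Lemma inv_inv x : inv (inv x) = x.
Proof. apply (mul_cancel_l (inv x)). rewrite mul_inv_r, Hinvl. reflexivity. Qed.

Lemma inv_mul x y : inv (mul x y) = mul (inv y) (inv x).
Proof.
  apply (mul_cancel_l (mul x y)). rewrite mul_inv_r, <- Hassoc, (Hassoc y), mul_inv_r, Hidl.
  symmetry; apply mul_inv_r.
Qed.

Lemma inv_id : inv e = e.
Proof. rewrite <- (Hinvl e) at 2. symmetry; apply mul_id_r. Qed.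

Lemma mul_inv_cancel_l x y : mul x (mul (inv x) y) = y.
Proof. rewrite Hassoc, mul_inv_r. apply Hidl. Qed.

Variable gens : list G.
Notation word_le := (word_len_le G mul inv e gens).
Notation norm := (word_norm G mul inv e gens).
Notation dist := (word_dist G mul inv e gens).
Hypothesis Hgen : generates G mul inv e gens.

Lemma word_le_mul g h m n : word_le g m -> word_le h n -> word_le (mul g h) (m + n).
Proof.
  intros (u & Hu & Hul & Hug) (v & Hv & Hvl & Hvh). exists (u ++ v). repeat split.
  - intros l Hl. apply in_app_or in Hl. destruct Hl; auto.
  - rewrite length_app. lia.
  - rewrite <- Hug, <- Hvh. clear - Hassoc Hidl. induction u as [|[b s] u IH]; simpl; [symmetry; apply Hidl|].
    rewrite IH. apply Hassoc.
Qed.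

Lemma word_le_inv g n : word_le g n -> word_le (inv g) n.
Proof.
  intros (u & Hu & Hul & <-). revert n Hul.
  induction u as [|[b s] u IH]; simpl; intros n Hul.
  - exists nil. rewrite inv_id. repeat split; simpl; [tauto|lia].
  - rewrite inv_mul. replace n with ((n - 1) + 1)%nat by lia. apply word_le_mul.
    + apply IH; [intros; apply Hu; right; assumption|lia].
    + exists ((negb b, s) :: nil). repeat split; simpl.
      * intros l [<-|[]]. apply (Hu (b, s)). left; reflexivity.
      * lia.
      * rewrite mul_id_r. destruct b; simpl; [reflexivity|symmetry; apply inv_inv].
Qed.

Lemma word_norm_spec g : word_le g (norm g) /\ forall m, word_le g m -> (norm g <= m)%nat.
Proof.
  unfold word_norm. destruct excluded_middle_informative as [H|H].
  - exact (proj2_sig (constructive_indefinite_description _ H)).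
  (* Generation excludes the default value 0: some length occurs, and descent yields a least one. *)
  - exfalso. destruct (Hgen g) as [n Hn]. revert Hn.
    induction n as [n IH] using lt_wf_ind. intro Hn. apply H. exists n. split; [exact Hn|].
    intros m Hm. destruct (Nat.le_gt_cases n m) as [|Hlt]; [assumption|].
    exfalso. exact (IH m Hlt Hm).
Qed.

Lemma word_norm_mul g h : (norm (mul g h) <= norm g + norm h)%nat.
Proof. apply word_norm_spec. apply word_le_mul; apply word_norm_spec. Qed.

Lemma word_norm_inv g : norm (inv g) = norm g.
Proof.
  assert (H : forall g, (norm (inv g) <= norm g)%nat).
  { intro h. apply word_norm_spec, word_le_inv, word_norm_spec. }
  pose proof (H g). pose proof (H (inv g)). rewrite inv_inv in H1. lia.
Qed.

Lemma word_norm_id : norm e = 0%nat.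
Proof.
  assert (norm e <= 0)%nat; [|lia]. apply word_norm_spec.
  exists nil. repeat split; simpl; [tauto|lia].
Qed.

Lemma word_norm_eq0 g : norm g = 0%nat -> g = e.
Proof.
  intro H. destruct (proj1 (word_norm_spec g)) as (u & _ & Hu & <-). rewrite H in Hu.
  destruct u; [reflexivity|simpl in Hu; lia].
Qed.

Lemma word_dist_left x y z : dist (mul x y) (mul x z) = dist y z.
Proof.
  unfold word_dist. rewrite inv_mul, <- Hassoc, (Hassoc (inv x)), Hinvl, Hidl. reflexivity.
Qed.

Lemma word_dist_metric : is_metric dist.
Proof.
  unfold word_dist. repeat split.
  - intros; apply pos_INR.
  - intro x. rewrite Hinvl, word_norm_id. reflexivity.
  - intros x y H. apply (INR_eq _ 0) in H. apply word_norm_eq0 in H.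
    apply (mul_cancel_l (inv x)). rewrite Hinvl. symmetry; exact H.
  - intros x y. rewrite <- word_norm_inv, inv_mul, inv_inv. reflexivity.
  - intros x y z. rewrite <- plus_INR. apply le_INR.
    replace (mul (inv x) z) with (mul (mul (inv x) y) (mul (inv y) z)).
    + apply word_norm_mul.
    + rewrite <- Hassoc, mul_inv_cancel_l. reflexivity.
Qed.

(** The point [z] follows [x] by the first letter of a shortest word. Together with integer values
    and finite neighbourhoods, this unit step is all that the study of ends uses of the word metric:
    the group enters there as a connected locally finite graph. *)
Lemma word_dist_step x y : x <> y -> exists z, dist x z <= 1 /\ dist z y <= dist x y - 1.
Proof.
  intro Hne. unfold word_dist.
  destruct (word_norm_spec (mul (inv x) y)) as [(u & Hu & Hul & Hug) _].
  destruct u as [|[b s] u].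
  - exfalso. apply Hne. apply (mul_cancel_l (inv x)). rewrite Hinvl. exact Hug.
  - set (a := if b then s else inv s). exists (mul x a). simpl in Hug, Hul. fold a in Hug.
    rewrite Hassoc, Hinvl, Hidl. split.
    + apply (le_INR _ 1). apply word_norm_spec. exists ((b, s) :: nil). repeat split.
      * intros l [<-|[]]. apply Hu. left; reflexivity.
      * simpl; lia.
      * simpl. apply mul_id_r.
    + rewrite inv_mul, <- Hassoc, <- Hug, Hassoc, Hinvl, Hidl.
      assert (Hle : (norm (word_val G mul inv e u) + 1 <= norm (mul a (word_val G mul inv e u)))%nat).
      { rewrite Hug. eapply Nat.le_trans; [|exact Hul].
        assert (norm (word_val G mul inv e u) <= length u)%nat; [|lia].
        apply word_norm_spec. exists u. repeat split; [|lia].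
        intros l Hl. apply Hu. right; exact Hl. }
      apply le_INR in Hle. rewrite plus_INR in Hle. simpl (INR 1) in Hle. lra.
Qed.

Lemma word_dist_neighbours x : exists l, forall y, dist x y <= 1 -> In y l.
Proof.
  exists (x :: map (fun s => mul x s) gens ++ map (fun s => mul x (inv s)) gens).
  intros y Hy. unfold word_dist in Hy. apply (INR_le _ 1) in Hy.
  destruct (word_norm_spec (mul (inv x) y)) as [(u & Hu & Hul & Hug) _].
  assert (Hyx : y = mul x (word_val G mul inv e u)) by (rewrite Hug, mul_inv_cancel_l; reflexivity).
  destruct u as [|[b s] [|? ?]]; simpl in Hul, Hyx; [..|lia].
  - left. rewrite Hyx, mul_id_r. reflexivity.
  - right. rewrite mul_id_r in Hyx. apply in_or_app. assert (Hs : In s gens) by (apply (Hu (b, s)); left; reflexivity).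
    destruct b; [left|right]; rewrite Hyx.
    + exact (in_map (fun s => mul x s) _ _ Hs).
    + exact (in_map (fun s => mul x (inv s)) _ _ Hs).
Qed.

End WordMetric.

(** * Ends *)

Lemma list_bound {X : Type} (f : X -> R) (l : list X) : exists M, forall x, In x l -> f x <= M.
Proof.
  induction l as [|a l [M HM]]; [exists 0; simpl; tauto|].
  exists (Rmax (f a) M). intros x [->|Hx]; [apply Rmax_l|].
  eapply Rle_trans; [apply HM; exact Hx|apply Rmax_r].
Qed.

Lemma nat_max_exists (P : nat -> Prop) (n : nat) :
  P 0%nat -> exists m, P m /\ forall k, (k <= n)%nat -> P k -> (k <= m)%nat.
Proof.
  intro H0. induction n as [|n [m [Hm HM]]].
  - exists 0%nat. auto.
  - destruct (classic (P (S n))) as [HS|HS].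
    + exists (S n). auto.
    + exists m. split; [exact Hm|]. intros k Hk HPk.
      destruct (Nat.eq_dec k (S n)) as [->|]; [contradiction|]. apply HM; [lia|exact HPk].
Qed.

Section Ends.

Variables (X : Type) (d : X -> X -> R) (o : X).
Hypothesis Hd : is_metric d.
Hypothesis Hint : forall x y, exists k, d x y = INR k.
Hypothesis Hstep : forall x y, x <> y -> exists z, d x z <= 1 /\ d z y <= d x y - 1.
Hypothesis Hnb : forall x, exists l, forall y, d x y <= 1 -> In y l.

Let dpos : forall x y, 0 <= d x y := proj1 Hd.
Let drefl : forall x, d x x = 0 := proj1 (proj2 Hd).
Let did : forall x y, d x y = 0 -> x = y := proj1 (proj2 (proj2 Hd)).
Let dsym : forall x y, d x y = d y x := proj1 (proj2 (proj2 (proj2 Hd))).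
Let dtri : forall x y z, d x z <= d x y + d y z := proj2 (proj2 (proj2 (proj2 Hd))).

Lemma ball_finite (N : nat) : exists l, forall x, d o x <= INR N -> In x l.
Proof.
  destruct (choice_fun _ Hnb) as [nb Hnb'].
  induction N as [|N [l Hl]].
  - exists (o :: nil). intros x Hx. left. apply did. pose proof (dpos o x). simpl in Hx. lra.
  - exists (o :: flat_map nb l). intros x Hx.
    destruct (classic (x = o)) as [->|Hne]; [left; reflexivity|right].
    destruct (Hstep x o Hne) as (z & Hz1 & Hz2). apply in_flat_map. exists z.
    rewrite S_INR in Hx. rewrite (dsym x o), (dsym z o) in Hz2. rewrite dsym in Hz1.
    split; [apply Hl; lra|auto].
Qed.

Lemma bounded_on_balls (f : X -> R) r : exists M, forall x, d o x <= r -> f x <= M.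
Proof.
  destruct (ball_finite (S (nfloor (Rabs r)))) as [l Hl].
  destruct (list_bound f l) as [M HM]. exists M. intros x Hx. apply HM, Hl.
  rewrite S_INR. pose proof (nfloor_spec (Rabs r) (Rabs_pos r)). pose proof (Rle_abs r). lra.
Qed.

(** Chains outside the open [r]-ball. The reflexive closure relates even a point inside the ball to
    itself, so a bound on an endpoint must be supplied separately when a chain is extracted. *)
Definition conn (r : R) : X -> X -> Prop :=
  clos_refl_trans X (fun x y => r <= d o x /\ r <= d o y /\ d x y <= 1).

Lemma conn_sym r x y : conn r x y -> conn r y x.
Proof.
  intro H. induction H as [x y (H1 & H2 & H3)| |].
  - apply rt_step. rewrite (dsym y x). auto.
  - apply rt_refl.
  - eapply rt_trans; eassumption.
Qed.

(** A geodesic from [x] to [y] stays within [d x y] of [x], too close to reach the ball. *)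
Lemma conn_near r x y : r + d x y <= d o x -> conn r x y.
Proof.
  destruct (Hint x y) as [k Hk]. revert x Hk.
  induction k as [k IH] using lt_wf_ind. intros x Hk Hr.
  destruct (classic (x = y)) as [->|Hne]; [apply rt_refl|].
  destruct (Hstep x y Hne) as (z & Hz1 & Hz2). destruct (Hint z y) as [k' Hk'].
  pose proof (dtri o z x). rewrite (dsym z x) in H. pose proof (dpos z y).
  apply rt_trans with z.
  - apply rt_step. repeat split; lra.
  - apply (IH k'); [apply INR_lt; lra|exact Hk'|lra].
Qed.

(** The equation puts [x] on a geodesic from [o] to [y], and beyond [x] such a geodesic only moves
    away from [o]. *)
Lemma conn_outward r x y : r <= d o x -> d o y = d o x + d x y -> conn r x y.
Proof.
  destruct (Hint x y) as [k Hk]. revert x Hk.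
  induction k as [k IH] using lt_wf_ind. intros x Hk Hr Ho.
  destruct (classic (x = y)) as [->|Hne]; [apply rt_refl|].
  destruct (Hstep x y Hne) as (z & Hz1 & Hz2). destruct (Hint z y) as [k' Hk'].
  pose proof (dtri o z y). pose proof (dtri o x z).
  apply rt_trans with z.
  - apply rt_step. repeat split; lra.
  - apply (IH k'); [apply INR_lt; lra|exact Hk'|lra|lra].
Qed.

Lemma conn_path r x y : r <= d o x -> conn r x y ->
  exists (w : nat -> X) (l : nat), w 0%nat = x /\ (forall k, (l <= k)%nat -> w k = y) /\
    (forall k, d (w k) (w (S k)) <= 1) /\ (forall k, r <= d o (w k)).
Proof.
  intros Hr H. apply clos_rt_rt1n in H. induction H as [x|x y z (H1 & H2 & H3) H IH].
  - exists (fun _ => x), 0%nat. repeat split; auto. intros; rewrite drefl; lra.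
  - destruct (IH H2) as (w & l & w0 & wl & w1 & wr).
    exists (fun k => match k with O => x | S k' => w k' end), (S l). repeat split.
    + intros [|k] Hk; [lia|]. apply wl; lia.
    + intros [|k]; [rewrite w0; exact H3|apply w1].
    + intros [|k]; auto.
Qed.

Lemma lipschitz_of_steps (g : nat -> X) :
  (forall k, d (g k) (g (S k)) <= 1) -> forall m n, d (g m) (g n) <= dnat m n.
Proof.
  intro Hg.
  assert (H : forall m k, d (g m) (g (k + m)%nat) <= INR k).
  { intros m k. induction k as [|k IH]; [simpl; rewrite drefl; lra|].
    rewrite S_INR. simpl. pose proof (dtri (g m) (g (k + m)%nat) (g (S (k + m)))).
    pose proof (Hg (k + m)%nat). lra. }
  assert (H' : forall m n, (m <= n)%nat -> d (g m) (g n) <= dnat m n).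
  { intros m n Hmn. pose proof (H m (n - m)%nat) as Hk.
    replace (n - m + m)%nat with n in Hk by lia. rewrite minus_INR in Hk by exact Hmn.
    unfold dnat. rewrite Rabs_minus_sym. pose proof (Rle_abs (INR n - INR m)). lra. }
  intros m n. destruct (Nat.le_ge_cases m n) as [Hmn|Hmn]; [auto|].
  rewrite dsym. unfold dnat. rewrite Rabs_minus_sym. apply H'; exact Hmn.
Qed.

Lemma konig_ray (Bad : X -> Prop) : (forall N, exists x, Bad x /\ N <= d o x) ->
  exists g : nat -> X, (forall k, d o (g k) = INR k) /\ (forall k, d (g k) (g (S k)) <= 1) /\
    forall k N, exists x, Bad x /\ N <= d o x /\ d o x = d o (g k) + d (g k) x.
Proof.
  intro HBad.
  set (P := fun x => forall N, exists y, Bad y /\ N <= d o y /\ d o y = d o x + d x y).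
  (* The invariant [P x] says that arbitrarily far bad points lie behind [x] on geodesics from [o].
     The existential precedes the premise so that choice yields a total successor map. *)
  assert (HP : forall x, exists z, P x -> d x z <= 1 /\ d o z = d o x + 1 /\ P z).
  { intro x. apply NNPP. intro Hn.
    assert (HPx : P x).
    { apply NNPP. intro H. apply Hn. exists x. intro; contradiction. }
    destruct (Hnb x) as [l Hl].
    (* If no neighbour inherited [P], each outward one would have a radius beyond which no bad point
       lies behind it; the maximum of these radii over the finitely many neighbours contradicts
       [P x]. *)
    assert (HN : forall z, exists N, d x z <= 1 -> d o z = d o x + 1 ->
              forall y, Bad y -> N <= d o y -> d o y <> d o z + d z y).
    { intro z. apply NNPP. intro H. apply Hn. exists z. intros _.
      assert (Hz : d x z <= 1 /\ d o z = d o x + 1).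
      { apply NNPP. intro H'. apply H. exists 0. intros; exfalso; tauto. }
      split; [tauto|split; [tauto|]]. intro N. apply NNPP. intro H'. apply H. exists N.
      intros _ _ y Hy HyN Hyz. apply H'. exists y; auto. }
    destruct (choice_fun _ HN) as [f Hf]. destruct (list_bound f l) as [M HM].
    destruct (HPx (Rmax M (d o x + 1))) as (y & Hy & HyN & Hyx).
    assert (Hne : x <> y).
    { intros <-. pose proof (Rmax_r M (d o x + 1)). lra. }
    destruct (Hstep x y Hne) as (z & Hz1 & Hz2).
    pose proof (dtri o x z). pose proof (dtri o z y).
    apply (Hf z Hz1) with y; auto; [lra| |lra].
    pose proof (HM z (Hl z Hz1)). pose proof (Rmax_l M (d o x + 1)). lra. }
  destruct (choice_fun _ HP) as [F HF].
  assert (HPo : P o).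
  { intro N. destruct (HBad N) as (y & Hy & HyN). exists y. rewrite drefl. repeat split; auto; lra. }
  set (g := fun k => Nat.iter k F o).
  assert (Hg : forall k, P (g k)).
  { induction k as [|k IH]; [exact HPo|]. apply (HF (g k) IH). }
  exists g. split; [|split].
  - induction k as [|k IH]; [apply drefl|]. rewrite S_INR, <- IH. apply (HF (g k) (Hg k)).
  - intro k. apply (HF (g k) (Hg k)).
  - intros k N. apply Hg.
Qed.

(** The radial condition gives the lower bound by the triangle inequality, so [g] is isometric and
    the integer part costs an additive 1. *)
Lemma ray_basepoint (g : nat -> X) :
  (forall k, d o (g k) = INR k) -> (forall k, d (g k) (g (S k)) <= 1) ->
  coarse_basepoint d (fun t => g (nfloor (proj1_sig t))).
Proof.
  intros Hg0 Hg1.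
  assert (Hup : forall m n, d (g m) (g n) <= dnat m n) by (apply lipschitz_of_steps; exact Hg1).
  assert (Hlow : forall m n, dnat m n <= d (g m) (g n)).
  { intros m n. unfold dnat. pose proof (dtri o (g m) (g n)). pose proof (dtri o (g n) (g m)).
    rewrite (dsym (g n) (g m)) in H0. rewrite !Hg0 in *. unfold Rabs; destruct Rcase_abs; lra. }
  assert (Hqg : forall s t : Rplus, dRp s t - 1 <= d (g (nfloor (proj1_sig s))) (g (nfloor (proj1_sig t))) <= dRp s t + 1).
  { intros [s Hs] [t Ht]. unfold dRp; simpl. pose proof (Hup (nfloor s) (nfloor t)).
    pose proof (Hlow (nfloor s) (nfloor t)). pose proof (nfloor_lt s t Hs Ht).
    split; [|lra]. eapply Rle_trans; [|exact H0]. unfold dnat.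
    pose proof (nfloor_spec s Hs). pose proof (nfloor_spec t Ht).
    repeat (unfold Rabs; destruct Rcase_abs); lra. }
  split; [split|].
  - intros r Hr. exists (r + 1). split; [lra|]. intros s t Hst. pose proof (Hqg s t). lra.
  - intros B [b Hb]. exists (b + 1). intros s t Hs Ht. pose proof (Hb _ _ Hs Ht).
    pose proof (Hqg s t). lra.
  - exists (fun t => g (nfloor (proj1_sig t))). split.
    + exists 1, 1. repeat split; try lra; rewrite ?Rinv_1, ?Rmult_1_l; apply Hqg.
    + exists 0. intro t. rewrite drefl; lra.
Qed.

(** Properness of the homotopy keeps the tracks over large [t] outside the ball of radius [r + s],
    where [s] bounds the jumps between consecutive integer times; the margin [s] lets [conn_near]
    fill each jump by a geodesic. *)
Lemma homotopic_conn (f g : Rplus -> X) (r : R) :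
  coarsely_homotopic dRp d f g -> exists T, forall t, T <= proj1_sig t -> conn r (f t) (g t).
Proof.
  intros (q & Hq & H & [Hc Hp] & H0 & H1).
  (* Consecutive clamped times differ by at most 1, hence by less than 2. *)
  destruct (Hc 2) as (s & Hs & HS); [lra|].
  destruct (Hp (fun x => d o x < r + s)) as [b Hb].
  { apply (ball_bounded d o _ (r + s) Hd). intros; lra. }
  assert (HT : exists T, forall p : Iq q, T <= proj1_sig (fst (proj1_sig p)) -> r + s <= d o (H p)).
  { destruct (classic (exists p, d o (H p) < r + s)) as [[p0 Hp0]|Hn].
    - exists (proj1_sig (fst (proj1_sig p0)) + b + 1). intros p HpT. apply Rnot_lt_le. intro Hlt.
      specialize (Hb p p0 Hlt Hp0). unfold dIq in Hb.
      pose proof (Rle_trans _ _ _ (Rmax_l _ _) Hb) as Hb'. unfold dRp in Hb'.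
      pose proof (Rle_abs (proj1_sig (fst (proj1_sig p)) - proj1_sig (fst (proj1_sig p0)))). lra.
    - exists 0. intros p _. apply Rnot_lt_le. intro Hlt. apply Hn; eauto. }
  destruct HT as [T HT]. exists T. intros t Ht.
  assert (Hcl : forall k, 0 <= snd (t, Rmin (INR k) (proj1_sig (q t)))
            <= proj1_sig (q (fst (t, Rmin (INR k) (proj1_sig (q t)))))).
  { intro k. simpl. split; [|apply Rmin_r]. apply Rmin_glb; [apply pos_INR|apply (proj2_sig (q t))]. }
  set (h := fun k => H (exist _ (t, Rmin (INR k) (proj1_sig (q t))) (Hcl k) : Iq q)).
  assert (Hh : forall k, conn r (f t) (h k)).
  { induction k as [|k IH].
    - rewrite <- H0. replace (h 0%nat) with (H (i0 q t)); [apply rt_refl|].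
      unfold h. f_equal. unfold i0. apply eq_sig_hprop; [intros; apply proof_irrelevance|]. simpl.
      f_equal. rewrite Rmin_left; [reflexivity|]. apply (proj2_sig (q t)).
    - eapply rt_trans; [exact IH|]. apply conn_near.
      assert (Hlt : d (h k) (h (S k)) < s).
      { apply HS. unfold dIq. simpl fst; simpl snd; simpl proj1_sig.
        unfold dRp. rewrite Rminus_diag, Rabs_R0.
        apply Rmax_lub_lt; [lra|].
        change (match k with O => 1 | S _ => INR k + 1 end) with (INR (S k)).
        rewrite S_INR. unfold Rmin.
        destruct (Rle_dec (INR k) (proj1_sig (q t))); destruct (Rle_dec (INR k + 1) (proj1_sig (q t)));
        unfold Rabs; destruct Rcase_abs; lra. }
      pose proof (HT (exist _ (t, Rmin (INR k) (proj1_sig (q t))) (Hcl k)) Ht).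
      fold (h k) in H2. lra. }
  set (N := S (nfloor (proj1_sig (q t)))).
  rewrite <- H1. replace (H (i1 q t)) with (h N); [apply Hh|].
  unfold h. f_equal. unfold i1. apply eq_sig_hprop; [intros; apply proof_irrelevance|]. simpl.
  f_equal. change (match nfloor (proj1_sig (q t)) with O => 1 | S _ => INR (nfloor (proj1_sig (q t))) + 1 end)
    with (INR N). unfold N. rewrite S_INR.
  apply Rmin_right. left. apply nfloor_spec. apply (proj2_sig (q t)).
Qed.

(** Otherwise a geodesic ray leads towards points that are cut off from [alpha]
    by a fixed ball, and this ray cannot be coarsely homotopic to [alpha]. *)
Lemma one_ended (alpha : Rplus -> X) :
  coarse_basepoint d alpha ->
  (forall f g, coarse_basepoint d f -> coarse_basepoint d g -> coarsely_homotopic dRp d f g) ->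
  forall r, exists r', forall x, r' <= d o x -> conn r x (alpha (rp (d o x))).
Proof.
  intros Ha Hcpc r. apply NNPP. intro Hn.
  destruct (konig_ray (fun x => ~ conn r x (alpha (rp (d o x))))) as (g & Hg0 & Hg1 & Hg2).
  { intro N. apply NNPP. intro H. apply Hn. exists N. intros x Hx. apply NNPP.
    intro H'. apply H; eauto. }
  destruct (homotopic_conn _ alpha r (Hcpc _ _ (ray_basepoint g Hg0 Hg1) Ha)) as [T HT].
  set (k := S (nfloor (Rabs r))).
  assert (Hk : r <= INR k).
  { unfold k. rewrite S_INR. pose proof (nfloor_spec (Rabs r) (Rabs_pos r)).
    pose proof (Rle_abs r). lra. }
  destruct (Hg2 k (Rmax T (INR k + 1))) as (x & Hbad & HxT & Hx). apply Hbad.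
  assert (Hx1 : T <= d o x) by (eapply Rle_trans; [apply Rmax_l|exact HxT]).
  assert (Hx2 : INR k + 1 <= d o x) by (eapply Rle_trans; [apply Rmax_r|exact HxT]).
  apply rt_trans with (g k).
  - apply conn_sym, conn_outward; [rewrite Hg0; exact Hk|exact Hx].
  - apply rt_trans with (g (nfloor (d o x))).
    + apply conn_outward; [rewrite Hg0; exact Hk|].
      assert (Hle : (k <= nfloor (d o x))%nat).
      { apply INR_le. pose proof (nfloor_spec (d o x) (dpos o x)). lra. }
      pose proof (lipschitz_of_steps g Hg1 k (nfloor (d o x))) as Hl. unfold dnat in Hl.
      apply le_INR in Hle. rewrite Rabs_left1 in Hl by lra.
      pose proof (dtri o (g k) (g (nfloor (d o x)))). rewrite !Hg0 in *. lra.
    + pose proof (HT (rp (d o x))) as HT'. rewrite rp_val in HT' by apply dpos. exact (HT' Hx1).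
Qed.

(** One chain per [p] must serve all radii [r]. It is chosen to avoid the largest possible ball
    among integer radii up to [nfloor (d o p)]; once [p] is far out, the hypothesis supplies a
    competitor avoiding any prescribed ball, so the chosen chain avoids it too. *)
Lemma escaping_paths (alpha : Rplus -> X) :
  (forall r, exists r', forall x, r' <= d o x -> conn r x (alpha (rp (d o x)))) ->
  exists (w : X -> nat -> X) (l : X -> nat),
    (forall p, w p 0%nat = alpha (rp (d o p))) /\
    (forall p k, (l p <= k)%nat -> w p k = p) /\
    (forall p k k', d (w p k) (w p k') <= dnat k k') /\
    (forall r, exists r', forall p k, d o (w p k) <= r -> d o p <= r').
Proof.
  intro Hend.
  set (Q := fun p m (wl : (nat -> X) * nat) => fst wl 0%nat = alpha (rp (d o p)) /\
         (forall k, (snd wl <= k)%nat -> fst wl k = p) /\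
         (forall k, d (fst wl k) (fst wl (S k)) <= 1) /\ (forall k, INR m <= d o (fst wl k))).
  assert (HQ : forall p m, INR m <= d o p -> conn (INR m) p (alpha (rp (d o p))) ->
            exists wl, Q p m wl).
  { intros p m Hm Hc. apply conn_sym in Hc.
    assert (Hm' : INR m <= d o (alpha (rp (d o p)))).
    { apply conn_sym in Hc. apply clos_rt_rtn1 in Hc. destruct Hc as [|? ? (_ & H & _)]; assumption. }
    destruct (conn_path _ _ _ Hm' Hc) as (w & l & Hw). exists (w, l). exact Hw. }
  assert (HQ0 : forall p, exists wl, Q p 0%nat wl).
  { intro p. apply HQ; [apply dpos|].
    set (y := alpha (rp (d o p))). generalize y. clear y. 
    (* For radius 0 any two points are joined through [o], so the maximum below ranges over a
       nonempty set. *)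
    assert (Ho : forall x, conn (INR 0) x o).
    { intro x. apply conn_sym. apply conn_outward; rewrite drefl; simpl; lra. }
    intro y. eapply rt_trans; [apply Ho|apply conn_sym, Ho]. }
  assert (Hbest : exists wl : X -> (nat -> X) * nat, forall p, exists m, Q p m (wl p) /\
            forall k, (k <= nfloor (d o p))%nat -> (exists v, Q p k v) -> (k <= m)%nat).
  { apply (choice_fun (fun p v => exists m, Q p m v /\
            forall k, (k <= nfloor (d o p))%nat -> (exists v, Q p k v) -> (k <= m)%nat)).
    intro p.
    destruct (nat_max_exists (fun m => exists v, Q p m v) (nfloor (d o p)) (HQ0 p)) as (m & [v Hv] & Hm).
    exists v, m. auto. }
  destruct Hbest as [wl Hwl].
  exists (fun p => fst (wl p)), (fun p => snd (wl p)). split; [|split; [|split]].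
  - intro p. destruct (Hwl p) as (m & HQm & _). apply HQm.
  - intros p. destruct (Hwl p) as (m & HQm & _). apply HQm.
  - intro p. destruct (Hwl p) as (m & HQm & _). apply lipschitz_of_steps. apply HQm.
  - intro r. set (m0 := S (nfloor (Rabs r))).
    assert (Hm0 : r < INR m0).
    { unfold m0. rewrite S_INR. pose proof (nfloor_spec (Rabs r) (Rabs_pos r)).
      pose proof (Rle_abs r). lra. }
    destruct (Hend (INR m0)) as [r' Hr']. exists (Rmax r' (INR m0)).
    intros p k Hk. apply Rnot_lt_le. intro Hlt.
    pose proof (Rmax_l r' (INR m0)). pose proof (Rmax_r r' (INR m0)).
    destruct (Hwl p) as (m & HQm & Hmax).
    assert (Hmm : (m0 <= m)%nat).
    { apply Hmax.
      - apply Nat.lt_succ_r, INR_lt. rewrite S_INR. pose proof (nfloor_spec (d o p) (dpos o p)). lra.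
      - apply HQ; [lra|]. apply Hr'. lra. }
    apply le_INR in Hmm. destruct HQm as (_ & _ & _ & HQm). pose proof (HQm k). lra.
Qed.

End Ends.

(** * The cover of the group and its transfer to [X] *)

Lemma categorical_cover {X : Type} (d : X -> X -> R) (o : X) (n : nat) :
  is_metric d ->
  (forall x y, exists k, d x y = INR k) ->
  (forall x y, x <> y -> exists z, d x z <= 1 /\ d z y <= d x y - 1) ->
  (forall x, exists l, forall y, d x y <= 1 -> In y l) ->
  bicombable d -> coarsely_path_connected d -> asdim_le d n ->
  exists U : nat -> X -> Prop,
    (forall i, coarsely_categorical d (U i)) /\
    (forall x, exists i, (i <= n)%nat /\ U i x).
Proof.
  intros Hd Hint Hstep Hnb [C HC] [[alpha Halpha] Hcpc] Has.
  pose proof Hd as (Hpos & Hrefl & Hid & Hsym & Htri).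
  destruct (escaping_paths X d o Hd Hint Hstep alpha
              (one_ended X d o Hd Hint Hstep Hnb alpha Halpha Hcpc))
    as (w & l & w0 & wend & wlip & wesc).
  (* Comparing [C p x m] with the constant combing line [C p p m = p] bounds the displacement
     uniformly in [p] and in the time [m]. *)
  assert (Hsig : exists sigma : R -> R, forall r, 0 <= sigma r /\
            forall p x m, d x p <= r -> d (C p x m) p <= sigma r).
  { apply (choice_fun (fun r s => 0 <= s /\ forall p x m, d x p <= r -> d (C p x m) p <= s)).
    intro r. destruct HC as (HCc & HC0 & HCp & HCe).
    pose proof (Rabs_pos r). destruct (HCc (Rabs r + 1)) as (s & Hs & HS); [lra|].
    exists s. split; [lra|]. intros p x m Hx. left.
    rewrite <- (HCp p m) at 2. apply (HS (p, x, m) (p, p, m)).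
    unfold dXXN; simpl. unfold dnat. rewrite Hrefl, Rminus_diag, Rabs_R0.
    pose proof (Rle_abs r). repeat apply Rmax_lub_lt; lra. }
  destruct Hsig as [sigma Hsig].
  destruct (spread_cover d o n sigma Hd Has (fun r => proj1 (Hsig r)))
    as (A & c & K0 & Hcov & Hsep & Hsm).
  exists A. split; [|exact Hcov]. intro i.
  apply (pieces_categorical d o (A i) (c i) C alpha w l (K0 / 2)); auto.
  - apply (bounded_on_balls X d o Hd Hstep Hnb).
  - intros x m Hx. destruct (Hsm i x Hx) as (D & HD1 & HD2).
    pose proof (proj2 (Hsig D) (c i x) x m HD1). lra.
  - apply Halpha.
Qed.

Theorem theorem5p11
  (G : Type) (mul : G -> G -> G) (inv : G -> G) (e : G)
  (Hassoc : forall x y z, mul x (mul y z) = mul (mul x y) z)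
  (Hidl : forall x, mul e x = x)
  (Hinvl : forall x, mul (inv x) x = e)
  (S : list G) (HS : generates G mul inv e S)
  (Hbic : bicombable (word_dist G mul inv e S))
  (Hcpc : coarsely_path_connected (word_dist G mul inv e S))
  (n : nat) (Hasdim : asdim_le (word_dist G mul inv e S) n)
  (X : Type) (dX : X -> X -> R) (x0 : X)
  (HdX : is_metric dX) (Hprop : proper_space dX) (Hgeo : geodesic_space dX)
  (act : G -> X -> X) (Hact : isometric_action mul e dX act)
  (Hpa : proper_action dX act) (Hcc : cocompact_action dX act) :
  ccat_le dX n.
Proof.
  pose proof (word_dist_metric G mul inv e Hassoc Hidl Hinvl S HS) as HdG.
  pose proof (word_dist_left G mul inv e Hassoc Hidl Hinvl S) as Hleft.
  pose proof (word_dist_step G mul inv e Hassoc Hidl Hinvl S HS) as Hstep.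
  pose proof (word_dist_neighbours G mul inv e Hassoc Hidl Hinvl S HS) as Hnb.
  destruct (categorical_cover (word_dist G mul inv e S) e n HdG
              (fun x y => ex_intro _ _ eq_refl) Hstep Hnb Hbic Hcpc Hasdim) as (U & HU & Hcov).
  set (dG := word_dist G mul inv e S) in *.
  pose proof HdX as (Xpos & Xrefl & Xid & Xsym & Xtri).
  destruct Hact as (Hact1 & Hactm & Hacti).
  destruct Hcc as (K & HK & HKcov).
  destruct (choice_fun _ HKcov) as [phi Hphi].
  destruct (compact_bounded dX x0 K HdX HK) as [D HD].
  assert (Hclose : forall x, dX (act (phi x) x0) x <= D).
  { intro x. destruct (Hphi x) as (y & Hy & Hxy). rewrite Hxy at 2. rewrite Hacti. auto. }
  assert (Horb : forall g h, dX (act g x0) (act h x0) = dX x0 (act (mul (inv g) h) x0)).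
  { intros g h. rewrite <- (Hacti (inv g)), <- !Hactm, Hinvl, Hact1. reflexivity. }
  assert (HdGe : forall g h, dG g h = dG e (mul (inv g) h)).
  { intros g h. rewrite <- (Hleft (inv g) g h), Hinvl. reflexivity. }
  (* Left invariance reduces to pairs starting at [e], and a ball of the word metric is finite. *)
  assert (Hup : forall r, exists s, forall g h, dG g h <= r -> dX (act g x0) (act h x0) <= s).
  { intro r. destruct (bounded_on_balls G dG e HdG Hstep Hnb (fun g => dX x0 (act g x0)) r) as [s Hs].
    exists s. intros g h Hgh. rewrite Horb. apply Hs. rewrite <- HdGe. exact Hgh. }
  assert (Hlow : forall r, exists s, forall g h, dX (act g x0) (act h x0) <= r -> dG g h <= s).
  { intro r. destruct (Hpa (fun y => dX x0 y <= Rmax 0 r)) as [l Hl]; [apply Hprop|].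
    destruct (list_bound (dG e) l) as [s Hs]. exists s. intros g h Hgh.
    rewrite HdGe. apply Hs, Hl. exists x0. split.
    - rewrite Xrefl. apply Rmax_l.
    - rewrite <- Horb. eapply Rle_trans; [exact Hgh|apply Rmax_r]. }
  assert (Hphi1 : forall x y, dX (act (phi x) x0) (act (phi y) x0) <= dX x y + 2 * D).
  { intros x y. pose proof (Hclose x). pose proof (Hclose y).
    pose proof (Xtri (act (phi x) x0) x (act (phi y) x0)).
    pose proof (Xtri x y (act (phi y) x0)). rewrite (Xsym y (act (phi y) x0)) in H2. lra. }
  assert (Hphi2 : forall x y, dX x y <= dX (act (phi x) x0) (act (phi y) x0) + 2 * D).
  { intros x y. pose proof (Hclose x). pose proof (Hclose y).
    pose proof (Xtri x (act (phi x) x0) y). pose proof (Xtri (act (phi x) x0) (act (phi y) x0) y).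
    rewrite (Xsym x (act (phi x) x0)) in H1. lra. }
  assert (Cphi : coarse dX dG phi).
  { split.
    - intros r Hr. destruct (Hlow (r + 2 * D)) as [s Hs]. exists (Rabs s + 1).
      split; [pose proof (Rabs_pos s); lra|]. intros x y Hxy.
      pose proof (Hphi1 x y). pose proof (Rle_abs s).
      assert (dG (phi x) (phi y) <= s) by (apply Hs; lra). lra.
    - intros B [b Hb]. destruct (Hup b) as [s Hs]. exists (s + 2 * D). intros x y Hx Hy.
      pose proof (Hphi2 x y). pose proof (Hs _ _ (Hb _ _ Hx Hy)). lra. }
  assert (Cpsi : coarse dG dX (fun g => act g x0)).
  { split.
    - intros r Hr. destruct (Hup r) as [s Hs]. exists (Rabs s + 1).
      split; [pose proof (Rabs_pos s); lra|]. intros g h Hgh. pose proof (Rle_abs s).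
      assert (dX (act g x0) (act h x0) <= s) by (apply Hs; lra). lra.
    - intros B [b Hb]. destruct (Hlow b) as [s Hs]. exists s. intros g h Hg Hh.
      apply Hs. apply Hb; assumption. }
  exists n. split; [apply le_n|]. exists (fun i x => U i (phi x)). split.
  - intros i _. exact (categorical_pullback dX dG phi (fun g => act g x0) D (U i) HdX Cphi Cpsi Hclose (HU i)).
  - intro x. apply Hcov.
Qed.
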